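(* Let $\varphi:T^n\times\mathbb R\to\mathbb R$ be Lipschitz continuous in both variables, with $\varphi(x,y+1)=\varphi(x,y)$ for all $(x,y)$ and $\int_{T^n\times[0,1)}\varphi(x,y)\,dx\,dy=0$, and let $F\ge0$. Suppose $g_1,g_2:T^n\times\mathbb R\to\mathbb R$ are classical solutions of $$g_t(x,t)=-(-\Delta)^{1/2}g(x,t)+\varphi(x,g(x,t))+F$$ and $T_1,T_2\in(0,\infty)$ are such that $g_i(x,t+T_i)=g_i(x,t)+1$ for all $x\in T^n$, $t\in\mathbb R$, $i=1,2$. Then $T_1=T_2$. Moreover, there exists $t_0\in\mathbb R$ such that $g_1(x,t)=g_2(x,t+t_0)$ for all $x\in T^n$, $t\in\mathbb R$.
   Context: $T^n$ is the $n$-dimensional flat torus, taken with side length $2\pi$, so that periodic functions have Fourier series indexed by $k\in\mathbb Z^n$, and $(-\Delta)^{1/2}$ (acting in $x$) is the Fourier multiplier $\widehat{(-\Delta)^{1/2}g}(k)=|k|\,\hat g(k)$. A classical solution of the evolution equation on $T^n\times\mathbb R$ is a continuous function $g$ on $T^n\times\mathbb R$ such that $g_t$ and $(-\Delta)^{1/2}g$ exist and are continuous on $T^n\times\mathbb R$ and the equation holds at every point. *)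

(* Defs.v *)
From HB Require Import structures.
From mathcomp Require Import all_boot all_order all_algebra.
From mathcomp Require Import all_classical all_reals all_analysis.
From mathcomp Require Import complex.

Set Implicit Arguments.
Unset Strict Implicit.
Unset Printing Implicit Defensive.

Import Order.TTheory GRing.Theory Num.Theory.
Import numFieldNormedType.Exports.

Local Open Scope classical_set_scope.
Local Open Scope ring_scope.

(* The torus T^n of side 2 pi is R^n modulo (2 pi Z)^n: a function on T^n is a
   function on 'rV[R]_n that is 2 pi-periodic in each coordinate. *)
Definition torus_periodic (R : realType) (n : nat) (u : 'rV[R]_n -> R) : Prop :=
  forall (x : 'rV[R]_n) (j : 'I_n), u (x + (2 * pi) *: delta_mx 0 j) = u x.

(* Integral over the fundamental domain [0, 2 pi)^n as an iterated Lebesgue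
   integral. By Fubini this is the integral over T^n for continuous u, the only
   case in which it is used. *)
Fixpoint torus_integral (R : realType) (n : nat) : ('rV[R]_n -> R) -> R :=
  match n with
  | 0 => fun u => u 0
  | m.+1 => fun u =>
      \int[@lebesgue_measure R]_(s in `[0, 2 * pi[)
        torus_integral (fun x : 'rV[R]_m => u (row_mx (s%:M : 'rV[R]_1) x))
  end.

Definition freq_dot (R : realType) (n : nat) (k : 'rV[int]_n) (x : 'rV[R]_n) : R :=
  \sum_(j < n) (k 0 j)%:~R * x 0 j.

(* Euclidean |k|; the library norm `|_| on row vectors is the sup norm. *)
Definition freq_norm (R : realType) (n : nat) (k : 'rV[int]_n) : R :=
  Num.sqrt (\sum_(j < n) (k 0 j)%:~R ^+ 2).

(* (2 pi)^-n * integral of u(x) exp (- i k . x) over T^n, for real-valued u,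
   split into its real and imaginary parts. *)
Definition fourier_coef (R : realType) (n : nat) (u : 'rV[R]_n -> R)
    (k : 'rV[int]_n) : R[i] :=
  Complex (torus_integral (fun x => u x * cos (freq_dot k x)) / (2 * pi) ^+ n)
          (- (torus_integral (fun x => u x * sin (freq_dot k x)) / (2 * pi) ^+ n)).

(* v = (-Delta)^(1/2) u. For periodic continuous u and v, the Fourier
   coefficients determine v uniquely. *)
Definition is_half_laplacian (R : realType) (n : nat) (u v : 'rV[R]_n -> R) : Prop :=
  forall k : 'rV[int]_n,
    fourier_coef v k = Complex (freq_norm R k) 0 * fourier_coef u k.

Definition continuous_torus_time (R : realType) (n : nat)
    (g : 'rV[R]_n -> R -> R) : Prop :=
  (forall t : R, torus_periodic (fun x => g x t)) /\
  continuous (fun p : 'rV[R]_n * R => g p.1 p.2).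

Definition classical_solution (R : realType) (n : nat)
    (phi : 'rV[R]_n -> R -> R) (F : R) (g : 'rV[R]_n -> R -> R) : Prop :=
  continuous_torus_time g /\
  exists gt Lg : 'rV[R]_n -> R -> R,
    [/\ continuous_torus_time gt,
        (forall x t, is_derive t (1 : R) (g x) (gt x t)),
        continuous_torus_time Lg,
        (forall t, is_half_laplacian (fun x => g x t) (fun x => Lg x t)) &
        (forall x t, gt x t = - Lg x t + phi x (g x t) + F)].

(* Main.v *)
Require Import Defs.
From HB Require Import structures.
From mathcomp Require Import all_boot all_order all_algebra.
From mathcomp Require Import all_classical all_reals all_analysis.
From mathcomp Require Import complex ring lra.

Import Order.TTheory GRing.Theory Num.Theory.
Import numFieldNormedType.Exports.

(* The difference [w] of (time shifts of) two solutions satisfies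
   [w_t = - (-Delta)^(1/2) w + O(|w|)], so everything rests on the positive
   maximum principle for [(-Delta)^(1/2)]: at a minimum of [w] it is [<= 0].
   For trigonometric polynomials this holds because [|k|] is a limit of
   multipliers [c (1 - m)] with [m] the symbol of an average of translates; it
   passes to continuous functions by convolution with the kernels
   [prod_j ((1 + cos x_j) / 2)^N].  The resulting comparison principle rules out
   [T1 < T2], since then [g2 - g1] tends to [+oo] as [t -> -oo] and to [-oo] as
   [t -> +oo].  For equal periods, let [s] be the least shift with
   [g1 x t <= g2 x (t + s)]; the two sides touch.  If they were different
   somewhere, the nonnegative periodic function [w = g2 (t + s) - g1] would
   dominate, up to an exponential factor, a solution of the linear equation with
   positive mean, hence be positive at all large times, and so everywhere. *)

Local Open Scope classical_set_scope.
Local Open Scope ring_scope.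

Set Implicit Arguments.
Unset Strict Implicit.
Unset Printing Implicit Defensive.

(** * Positive multipliers of trigonometric polynomials *)

(** The half Laplacian is given only through Fourier coefficients, and solutions carry no assumed
    smoothness in [x], so a sign at a single point must be reached by approximation. The relation
    between [u] and its half Laplacian is therefore carried as [trig_approx]: one trigonometric
    polynomial is uniformly close to [u] while its image under [|k|] is uniformly close to the other
    function. The passage from [|k|^2] to [|k|] rests on the power series of [1 - sqrt (1 - z)],
    whose coefficients are nonnegative: one minus a positive multiplier keeps that form under the
    square root. Strong positivity is obtained without a lower bound on the Poisson kernel:
    positivity at late times is enough, because both solutions gain 1 over the common period, so
    their difference is periodic in time and brings late positivity back to every time. *)

Lemma freq_dotDl (R : realType) (n : nat) (k l : 'rV[int]_n) (x : 'rV[R]_n) :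
  freq_dot (k + l) x = freq_dot k x + freq_dot l x.
Proof.
rewrite /freq_dot -big_split; apply: eq_bigr => j _ /=.
by rewrite mxE intrD mulrDl.
Qed.

Lemma freq_dotNl (R : realType) (n : nat) (k : 'rV[int]_n) (x : 'rV[R]_n) :
  freq_dot (- k) x = - freq_dot k x.
Proof.
by rewrite /freq_dot -sumrN; apply: eq_bigr => j _; rewrite mxE mulrNz mulNr.
Qed.

Lemma freq_dotDr (R : realType) (n : nat) (k : 'rV[int]_n) (x y : 'rV[R]_n) :
  freq_dot k (x + y) = freq_dot k x + freq_dot k y.
Proof.
rewrite /freq_dot -big_split; apply: eq_bigr => j _ /=.
by rewrite mxE mulrDr.
Qed.

Lemma freq_dotNr (R : realType) (n : nat) (k : 'rV[int]_n) (x : 'rV[R]_n) :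
  freq_dot k (- x) = - freq_dot k x.
Proof.
by rewrite /freq_dot -sumrN; apply: eq_bigr => j _; rewrite mxE mulrN.
Qed.

Lemma freq_dot0l (R : realType) (n : nat) (x : 'rV[R]_n) :
  freq_dot (0 : 'rV[int]_n) x = 0.
Proof. by rewrite /freq_dot big1 // => j _; rewrite mxE mul0r. Qed.

Lemma freq_dot_deltar (R : realType) (n : nat) (k : 'rV[int]_n) (a : R)
  (j : 'I_n) : freq_dot k (a *: delta_mx 0 j) = a * (k 0 j)%:~R.
Proof.
rewrite /freq_dot (bigD1 j) //= big1 => [|i /negbTE ij].
  by rewrite !mxE !eqxx mulr1 addr0 mulrC.
by rewrite !mxE ij andbF !mulr0.
Qed.

Lemma freq_dot_deltal (R : realType) (n : nat) (j : 'I_n) (x : 'rV[R]_n) :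
  freq_dot (delta_mx 0 j) x = x 0 j.
Proof.
rewrite /freq_dot (bigD1 j) //= big1 => [|i /negbTE ij].
  by rewrite !mxE !eqxx mul1r addr0.
by rewrite !mxE ij andbF mul0r.
Qed.

Lemma freq_norm0 (R : realType) (n : nat) : freq_norm R (0 : 'rV[int]_n) = 0.
Proof. by rewrite /freq_norm big1 ?sqrtr0 // => j _; rewrite mxE expr0n. Qed.

Lemma freq_norm_delta (R : realType) (n : nat) (j : 'I_n) :
  freq_norm R (delta_mx 0 j : 'rV[int]_n) = 1.
Proof.
rewrite /freq_norm (bigD1 j) //= big1 => [|i /negbTE ij].
  by rewrite !mxE !eqxx expr1n addr0 sqrtr1.
by rewrite !mxE ij andbF expr0n.
Qed.

Lemma freq_norm_ge1 (R : realType) (n : nat) (k : 'rV[int]_n) :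
  k != 0 -> 1 <= freq_norm R k.
Proof.
move=> k0; have [j kj] : exists j, k 0 j != 0.
  apply/existsP; apply: contraNT k0; rewrite negb_exists => /forallP k0.
  by apply/eqP/rowP => j; rewrite mxE; apply/eqP; have := k0 j; rewrite negbK.
rewrite /freq_norm -[leLHS]sqrtr1 ler_wsqrtr // (bigD1 j) //=.
rewrite -[leLHS]addr0 lerD ?sumr_ge0 // => [|i _]; last exact: sqr_ge0.
rewrite -rmorphXn /= -[1]/(1%:~R) ler_int -gtz0_ge1 lt_def sqr_ge0 andbT.
by rewrite expf_neq0.
Qed.

(* Formal trigonometric polynomials: the term [(k, (a, b))] stands for
   [a cos(k.x) + b sin(k.x)]; frequencies may be repeated. *)
Definition trig_eval (R : realType) (n : nat)
    (s : seq ('rV[int]_n * (R * R))) (x : 'rV[R]_n) : R :=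
  \sum_(t <- s) (t.2.1 * cos (freq_dot t.1 x) + t.2.2 * sin (freq_dot t.1 x)).

Definition trig_mul (R : realType) (n : nat) (m : 'rV[int]_n -> R)
    (s : seq ('rV[int]_n * (R * R))) : seq ('rV[int]_n * (R * R)) :=
  [seq (t.1, (m t.1 * t.2.1, m t.1 * t.2.2)) | t <- s].

Lemma trig_mulE (R : realType) (n : nat) (m : 'rV[int]_n -> R) s
  (x : 'rV[R]_n) : trig_eval (trig_mul m s) x =
  \sum_(t <- s) m t.1 *
    (t.2.1 * cos (freq_dot t.1 x) + t.2.2 * sin (freq_dot t.1 x)).
Proof.
by rewrite /trig_eval big_map; apply: eq_bigr => t _ /=; rewrite mulrDr !mulrA.
Qed.

Lemma trig_eval_cat (R : realType) (n : nat) s1 s2 (x : 'rV[R]_n) :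
  trig_eval (s1 ++ s2) x = trig_eval s1 x + trig_eval s2 x.
Proof. by rewrite /trig_eval big_cat. Qed.

Lemma trig_mul_cat (R : realType) (n : nat) (m : 'rV[int]_n -> R) s1 s2 :
  trig_mul m (s1 ++ s2) = trig_mul m s1 ++ trig_mul m s2.
Proof. exact: map_cat. Qed.

Lemma trig_eval_scale (R : realType) (n : nat) (c : R) s (x : 'rV[R]_n) :
  trig_eval (trig_mul (fun=> c) s) x = c * trig_eval s x.
Proof. by rewrite trig_mulE -mulr_sumr. Qed.

Lemma trig_mul_comp (R : realType) (n : nat) (m1 m2 : 'rV[int]_n -> R) s
  (x : 'rV[R]_n) :
  trig_eval (trig_mul m1 (trig_mul m2 s)) x =
  trig_eval (trig_mul (fun k => m1 k * m2 k) s) x.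
Proof.
rewrite !trig_mulE big_map; apply: eq_bigr => t _ /=.
by ring.
Qed.

(** Fourier-side form of convolution with a positive measure. Closure under sums and products,
    together with constants and [cos (h * k_j)], yields every multiplier used below. *)
Definition positive_multiplier (R : realType) (n : nat)
    (m : 'rV[int]_n -> R) : Prop :=
  forall s, (forall x, 0 <= trig_eval s x) ->
    forall x, 0 <= trig_eval (trig_mul m s) x.

Lemma positive_multiplierM (R : realType) (n : nat) (m1 m2 : 'rV[int]_n -> R) :
  positive_multiplier m1 -> positive_multiplier m2 ->
  positive_multiplier (fun k => m1 k * m2 k).
Proof.
by move=> p1 p2 s s0 x; rewrite -trig_mul_comp; apply: p1; apply: p2.
Qed.

Lemma positive_multiplierD (R : realType) (n : nat) (m1 m2 : 'rV[int]_n -> R) :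
  positive_multiplier m1 -> positive_multiplier m2 ->
  positive_multiplier (fun k => m1 k + m2 k).
Proof.
move=> p1 p2 s s0 x; rewrite trig_mulE.
under eq_bigr do rewrite mulrDl.
by rewrite big_split /= -!trig_mulE addr_ge0 ?p1 ?p2.
Qed.

Lemma positive_multiplier_cst (R : realType) (n : nat) (c : R) : 0 <= c ->
  positive_multiplier (fun _ : 'rV[int]_n => c).
Proof. by move=> c0 s s0 x; rewrite trig_eval_scale mulr_ge0. Qed.

Lemma positive_multiplier_sum (R : realType) (n : nat) (I : Type) (r : seq I)
  (m : I -> 'rV[int]_n -> R) : (forall i, positive_multiplier (m i)) ->
  positive_multiplier (fun k => \sum_(i <- r) m i k).
Proof.
move=> mp; elim: r => [|i r IH] s s0 x.
  rewrite trig_mulE big1_seq // => t _.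
  by rewrite big_nil mul0r.
have := positive_multiplierD (mp i) IH s0 x.
by rewrite !trig_mulE; under [in X in _ -> X]eq_bigr do rewrite big_cons.
Qed.

(* The multiplier averages the two translates by [h] in direction [j]. *)
Lemma positive_multiplier_cos (R : realType) (n : nat) (h : R) (j : 'I_n) :
  positive_multiplier (fun k : 'rV[int]_n => cos (h * (k 0 j)%:~R)).
Proof.
move=> s s0 x.
have -> : trig_eval (trig_mul (fun k => cos (h * (k 0 j)%:~R)) s) x =
    (trig_eval s (x + h *: delta_mx 0 j) + trig_eval s (x - h *: delta_mx 0 j))
    / 2.
  rewrite trig_mulE /trig_eval -big_split mulr_suml; apply: eq_bigr => t _ /=.
  rewrite !freq_dotDr freq_dotNr !freq_dot_deltar cosD sinD cosB sinB.
  by field.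
by rewrite divr_ge0 ?addr_ge0.
Qed.

Lemma cvg_trig_mul (R : realType) (n : nat) (T : Type) (F : set_system T)
  (FF : Filter F) (m : T -> 'rV[int]_n -> R) (l : 'rV[int]_n -> R) s x :
  (forall k, m i k @[i --> F] --> l k) ->
  trig_eval (trig_mul (m i) s) x @[i --> F] --> trig_eval (trig_mul l s) x.
Proof.
move=> ml; rewrite trig_mulE; under eq_fun do rewrite trig_mulE.
apply: cvg_big => [|t _]; first exact: add_continuous.
by apply: cvgM => //; exact: cvg_cst.
Qed.

(* Iterating [y |-> (z + y^2) / 2] from [0] converges to [1 - sqrt (1 - z)]
   through polynomials in [z] with nonnegative coefficients. *)
Fixpoint sqrt_iter (R : realType) (z : R) (i : nat) : R :=
  if i is i'.+1 then (z + sqrt_iter z i' ^+ 2) / 2 else 0.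

(** The error [e] becomes [e * (1 - r) - e^2 / 2 <= e - e^2 / 2], and [e - e^2 / 2] is increasing on
    [[0, 1]], so the bound [2 / (i + 2)] propagates. The rate is uniform in [r], including [r = 0],
    where there is no linear contraction. *)
Lemma sqrt_iter_bound (R : realType) (r : R) (i : nat) : 0 <= r <= 1 ->
  0 <= 1 - r - sqrt_iter (1 - r ^+ 2) i <= 2 / i.+2%:R /\
  0 <= sqrt_iter (1 - r ^+ 2) i.
Proof.
move=> /andP[r0 r1]; elim: i => [|i [/andP[IH1 IH2] IH3]] /=.
  by rewrite subr0 divff // ?pnatr_eq0 //; split; [apply/andP; split; lra|].
set y := sqrt_iter _ i in IH1 IH2 IH3 *.
have r2 : r ^+ 2 <= 1 by rewrite expr_le1.
have E : 1 - r - (1 - r ^+ 2 + y ^+ 2) / 2 = (1 - r - y) * (1 - r + y) / 2.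
  by field.
split; last by rewrite divr_ge0 // addr_ge0 ?sqr_ge0 // subr_ge0.
rewrite E; apply/andP; split.
  by rewrite divr_ge0 // mulr_ge0 // addr_ge0 //; lra.
set e := 1 - r - y in IH1 IH2 *.
have {E} : e * (1 - r + y) / 2 <= e - e ^+ 2 / 2.
  have -> : 1 - r + y = 2 * (1 - r) - e by rewrite /e; ring.
  nra.
move=> /le_trans; apply.
pose a : R := i%:R.
have a0 : 0 <= a by rewrite ler0n.
have E2 : i.+2%:R = a + 2 by rewrite -addn2 natrD.
have E3 : i.+3%:R = a + 3 by rewrite -addn3 natrD.
rewrite E2 in IH2; rewrite E3.
set d := 2 / (a + 2) in IH2.
have d1 : d <= 1 by rewrite /d ler_pdivrMr; lra.
apply: (@le_trans _ _ (d - d ^+ 2 / 2)); first by nra.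
rewrite /d -subr_ge0.
have -> : 2 / (a + 3) - (2 / (a + 2) - (2 / (a + 2)) ^+ 2 / 2) =
    2 / ((a + 3) * (a + 2) ^+ 2).
  by field; apply/andP; split; apply/eqP; lra.
by rewrite divr_ge0 // mulr_ge0 ?sqr_ge0 //; lra.
Qed.

Lemma cvg_sqrt_iter (R : realType) (r : R) : 0 <= r <= 1 ->
  sqrt_iter (1 - r ^+ 2) i @[i --> \oo] --> 1 - r.
Proof.
move=> r01; apply/cvgrPdist_le => e e0.
have := @cvg_harmonic R; move/cvgrPdist_le => /(_ (e / 2)) /(_ _)[|N _ HN].
  by rewrite divr_gt0.
exists N => // i /= /HN /=; rewrite sub0r normrN ger0_norm ?invr_ge0 // => Hi.
have [/andP[H1 H2] _] := sqrt_iter_bound i r01.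
rewrite ger0_norm //; apply: (le_trans H2).
have : (i.+2%:R : R)^-1 <= i.+1%:R^-1.
  by rewrite lef_pV2 ?posrE ?ltr0n // ler_nat.
move: Hi; move: (i.+1%:R^-1 : R) (i.+2%:R^-1 : R) => *; lra.
Qed.

(** Since [1 - cos (2 y) = 2 sin(y)^2], the expression is the square of the difference quotient at 0
    of [2 * sin (h * (a / 2))], whose derivative there is [a]. *)
Lemma cvg_scaled_cos (R : realType) (a : R) :
  (1 - cos (h * a)) * (2 / h ^+ 2) @[h --> 0^'] --> a ^+ 2.
Proof.
have D : is_derive (0 : R) 1 (fun h : R => 2 * sin (h * (a / 2))) a.
  by apply: is_derive_eq; rewrite /GRing.scale /= mul0r cos0; field.
have [Dd De] := D.
have : (h^-1 *: (2 * sin ((h *: 1 + 0) * (a / 2)) - 2 * sin (0 * (a / 2))))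
    @[h --> 0^'] --> a.
  by rewrite -[X in _ --> X]De; exact: Dd.
move=> C; rewrite expr2; apply: (cvg_trans _ (cvgM C C)).
apply: near_eq_cvg; near=> h.
have h0 : h != 0 by near: h; exact: nbhs_dnbhs_neq.
have -> : h * a = (h * (a / 2)) *+ 2 by rewrite -mulr_natr; field.
rewrite cos_mulr2n /GRing.scale /= mulr1 addr0 mul0r sin0 mulr0 subr0.
have := sin2cos2 (h * (a / 2)).
move: (sin _) (cos _) => S C2 SC.
rewrite -(mulr_natr (C2 ^+ 2)).
have -> : h^-1 * (2 * S) * (h^-1 * (2 * S)) = 4 * S ^+ 2 / h ^+ 2 by field.
by rewrite SC; field.
Unshelve. all: by end_near. Qed.

Lemma positive_multiplier_sqrt_iter (R : realType) (n : nat)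
  (z : 'rV[int]_n -> R) (i : nat) : positive_multiplier z ->
  positive_multiplier (fun k => sqrt_iter (z k) i).
Proof.
move=> zp; elim: i => [|i IH] /=; first exact: positive_multiplier_cst.
apply: (@positive_multiplierM _ _ (fun k => z k + sqrt_iter (z k) i ^+ 2)).
  apply: positive_multiplierD => //.
  exact: (positive_multiplierM IH IH).
by apply: positive_multiplier_cst; rewrite invr_ge0.
Qed.

(** As a limit of the positive multipliers [sqrt_iter (1 - r ^+ 2)], the symbol [1 - r] is positive;
    at a zero of a nonnegative polynomial only the contribution of [- r] is left. *)
Lemma sqrt_multiplier_le0 (R : realType) (n : nat) (r : 'rV[int]_n -> R)
  (s : seq ('rV[int]_n * (R * R))) (x0 : 'rV[R]_n) :
  (forall k, 0 <= r k <= 1) -> positive_multiplier (fun k => 1 - r k ^+ 2) ->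
  (forall x, 0 <= trig_eval s x) -> trig_eval s x0 = 0 ->
  trig_eval (trig_mul r s) x0 <= 0.
Proof.
move=> r01 rp s0 sx0.
have C : trig_eval (trig_mul (fun k => sqrt_iter (1 - r k ^+ 2) i) s) x0
    @[i --> \oo] --> trig_eval (trig_mul (fun k => 1 - r k) s) x0.
  by apply: cvg_trig_mul => k; exact: cvg_sqrt_iter.
have : 0 <= trig_eval (trig_mul (fun k => 1 - r k) s) x0.
  rewrite -(cvg_lim _ C) //; apply: limr_ge; first by apply/cvg_ex; eexists; exact: C.
  by apply: nearW => i; exact: positive_multiplier_sqrt_iter.
have -> : trig_eval (trig_mul (fun k => 1 - r k) s) x0 =
    trig_eval s x0 - trig_eval (trig_mul r s) x0.
  rewrite !trig_mulE /trig_eval -sumrB; apply: eq_bigr => t _.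
  by rewrite mulrBl mul1r.
by rewrite sx0 sub0r oppr_ge0.
Qed.

(* Discretize [|k|^2] by the symbol [sum_j 2 (1 - cos (h k_j)) / h^2] of the
   nearest-neighbour Laplacian; up to scaling, it is one minus the positive
   symbol of a lazy random walk of step [h]. *)
Lemma trig_half_laplacian_le0 (R : realType) (n : nat)
  (s : seq ('rV[int]_n * (R * R))) (x0 : 'rV[R]_n) :
  (forall x, trig_eval s x0 <= trig_eval s x) ->
  trig_eval (trig_mul (freq_norm R (n := n)) s) x0 <= 0.
Proof.
move=> smin.
(* Subtracting the minimum only adds a term of frequency 0, where [|k|] vanishes. *)
wlog [s0 sx0] : s smin / (forall x, 0 <= trig_eval s x) /\ trig_eval s x0 = 0.
  move=> W; pose s' := (0, (- trig_eval s x0, 0)) :: s.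
  have s'E x : trig_eval s' x = trig_eval s x - trig_eval s x0.
    by rewrite /s' {1}/trig_eval big_cons /= freq_dot0l cos0 sin0 addrC
      mulr0 mulr1 addr0.
  have := W s'; rewrite trig_mulE big_cons /= freq_norm0 mul0r add0r.
  rewrite -trig_mulE; apply.
    by move=> x; rewrite !s'E lerD2r.
  by split => [x|]; rewrite s'E ?subrr ?subr_ge0.
(* Each [1 - cos] is at most 2, so dividing by [2 (n + 1)] puts the symbol in [[0, 1]]; [n + 1]
   keeps the divisor nonzero when [n = 0]. The complement is then [(sum_j (1 + cos) + 2) / N],
   visibly a positive multiplier. *)
pose N : R := 2 * n.+1%:R.
have N0 : 0 < N by rewrite mulr_gt0 // ltr0n.
pose psi (h : R) (k : 'rV[int]_n) := (\sum_(j < n) (1 - cos (h * (k 0 j)%:~R))) / N.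
have psi0 h k : 0 <= psi h k.
  by rewrite divr_ge0 ?(ltW N0) // sumr_ge0 // => j _; rewrite subr_ge0 cos_le1.
have psi1 h k : psi h k <= 1.
  rewrite ler_pdivrMr // mul1r (@le_trans _ _ (\sum_(j < n) 2)) //.
    by apply: ler_sum => j _; have := cos_geN1 (h * (k 0 j)%:~R); lra.
  rewrite sumr_const card_ord /N -(mulr_natr 2 n).
  by rewrite ler_pM2l // ler_nat.
have posz h : positive_multiplier (fun k => 1 - Num.sqrt (psi h k) ^+ 2).
  have E k : 1 - Num.sqrt (psi h k) ^+ 2 =
      (\sum_(j < n) (1 + cos (h * (k 0 j)%:~R)) + 2) * N^-1.
    rewrite sqr_sqrtr // /psi -[X in X - _](divff (lt0r_neq0 N0)) -mulrBl.
    congr (_ * _); rewrite sumrB big_split /= sumr_const card_ord /N.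
    by rewrite -natr1; ring.
  rewrite (funext E); apply: positive_multiplierM => //.
    apply: positive_multiplierD; last exact: positive_multiplier_cst.
    apply: positive_multiplier_sum => j; apply: positive_multiplierD.
      exact: positive_multiplier_cst.
    exact: positive_multiplier_cos.
  by apply: positive_multiplier_cst; rewrite invr_ge0 ltW.
(* This scale cancels [N] and restores the factor [2 / h^2], so that [c h * sqrt (psi h k)] tends to
   [|k|]. *)
pose c (h : R) := Num.sqrt (N * (2 / h ^+ 2)).
have c0 h : 0 <= c h by exact: sqrtr_ge0.
have C : trig_eval (trig_mul (fun k => c h * Num.sqrt (psi h k)) s) x0
    @[h --> 0^'] --> trig_eval (trig_mul (freq_norm R (n := n)) s) x0.
  apply: cvg_trig_mul => k; rewrite /freq_norm.
  have -> : (fun h => c h * Num.sqrt (psi h k)) = (fun h => Num.sqrt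
      (\sum_(j < n) (1 - cos (h * (k 0 j)%:~R)) * (2 / h ^+ 2))).
    apply/funext => h; rewrite -sqrtrM; last first.
      by rewrite mulr_ge0 ?(ltW N0) // divr_ge0 ?sqr_ge0.
    congr Num.sqrt; rewrite /psi -mulr_suml.
    set S := \sum_(j < n) _.
    by rewrite [LHS]mulrC -[S / N * _]mulrA mulKf // gt_eqF.
  apply: continuous_cvg; first exact: sqrt_continuous.
  by apply: cvg_big => [|j _]; [exact: add_continuous|exact: cvg_scaled_cos].
rewrite -(cvg_lim _ C) //; apply: limr_le; first by apply/cvg_ex; eexists; exact: C.
apply: nearW => h.
have -> : trig_eval (trig_mul (fun k => c h * Num.sqrt (psi h k)) s) x0 =
    c h * trig_eval (trig_mul (fun k => Num.sqrt (psi h k)) s) x0.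
  by rewrite -trig_eval_scale trig_mul_comp.
rewrite mulr_ge0_le0 //; apply: sqrt_multiplier_le0 => // k.
by rewrite sqrtr_ge0 -[leRHS]sqrtr1 ler_wsqrtr.
Qed.

(** * Periodic continuous functions *)

Definition torus_continuous (R : realType) (n : nat) (u : 'rV[R]_n -> R) : Prop :=
  continuous u /\ torus_periodic u.

Definition torus_shift (R : realType) (n : nat) (m : 'rV[int]_n) : 'rV[R]_n :=
  \row_j ((2 * pi) * (m 0 j)%:~R).

Lemma torus_periodic_shift (R : realType) (n : nat) (u : 'rV[R]_n -> R) m x :
  torus_periodic u -> u (x + torus_shift R m) = u x.
Proof.
move=> up.
have step (z : int) (y : 'rV[R]_n) (j : 'I_n) :
    u (y + ((2 * pi) * z%:~R) *: delta_mx 0 j) = u y.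
  have pos (i : nat) (v : 'rV[R]_n) :
      u (v + ((2 * pi) * i%:R) *: delta_mx 0 j) = u v.
    elim: i v => [|i IH] v; first by rewrite mulr0 scale0r addr0.
    by rewrite -[i.+1%:R]natr1 mulrDr mulr1 scalerDl addrA up IH.
  case: z => i; first exact: pos.
  by rewrite NegzE mulrNz mulrN scaleNr -[LHS](pos i.+1) subrK.
have -> : torus_shift R m =
    \sum_(j <- enum 'I_n) ((2 * pi) * (m 0 j)%:~R) *: delta_mx 0 j.
  by rewrite big_enum [LHS]row_sum_delta; apply: eq_bigr => j _; rewrite mxE.
elim: (enum _) x => [|j s IH] x; first by rewrite big_nil addr0.
by rewrite big_cons addrA IH step.
Qed.

Lemma torus_reduce (R : realType) (n : nat) (x : 'rV[R]_n) :
  exists m, forall j, `|(x + torus_shift R m) 0 j| <= pi.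
Proof.
have p0 : 0 < 2 * pi :> R by rewrite mulr_gt0 // pi_gt0.
exists (\row_j - Num.floor ((x 0 j + pi) / (2 * pi))) => j.
rewrite !mxE; set r := (_ + pi) / _.
have rE : x 0 j = r * (2 * pi) - pi by rewrite /r divfK ?gt_eqF // addrK.
have h1 := Num.Theory.floor_le r; have h2 := Num.Theory.floorD1_gt r.
rewrite rE mulrNz ler_norml.
move: h1 h2; rewrite intrD => h1 h2.
apply/andP; split; nra.
Qed.

Lemma compact_cube (R : realType) (n : nat) :
  compact [set x : 'rV[R]_n | forall j, `|x 0 j| <= pi].
Proof.
have := @rV_compact R n (fun=> `[- pi, pi]%classic) (fun=> @segment_compact _ _ _).
congr compact; apply/funext => x; apply/propext; split => /= H j;
  by have := H j; rewrite in_itv /= ler_norml.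
Qed.

Lemma torus_time_min (R : realType) (n : nat) (f : 'rV[R]_n -> R -> R) (a b : R) :
  continuous_torus_time f -> a <= b ->
  exists x0 t0, a <= t0 <= b /\ forall x t, a <= t <= b -> f x0 t0 <= f x t.
Proof.
move=> [fp fc] ab.
have K := compact_setX (@compact_cube R n) (@segment_compact _ a b).
have [||[x0 t0]] := @compact_EVT_min _ _ (fun p => f p.1 p.2) _ _ K.
- exists (0, a); split => /=; last by rewrite in_itv /= lexx.
  by move=> j; rewrite mxE normr0 pi_ge0.
- exact: continuous_subspaceT.
rewrite inE => -[_ /=]; rewrite in_itv /= => tab H.
exists x0, t0; split => // x t tab'.
have [m mP] := torus_reduce x.
rewrite -(torus_periodic_shift m x (fp t)).
by apply: (H (x + torus_shift R m, t)); rewrite inE; split => //=; rewrite in_itv.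
Qed.

Lemma torus_continuous_time (R : realType) (n : nat) (u : 'rV[R]_n -> R) :
  torus_continuous u -> continuous_torus_time (fun x (_ : R) => u x).
Proof.
move=> [uc up]; split => // p.
by apply: (@continuous_comp _ _ _ fst u); [exact: cvg_fst|exact: uc].
Qed.

Lemma continuous_torus_timeN (R : realType) (n : nat) (f : 'rV[R]_n -> R -> R) :
  continuous_torus_time f -> continuous_torus_time (fun x t => - f x t).
Proof.
move=> [fp fc]; split => [t x j|p]; first by rewrite fp.
by apply: continuousN; exact: fc.
Qed.

Lemma torus_time_bounded (R : realType) (n : nat) (f : 'rV[R]_n -> R -> R)
  (a b : R) : continuous_torus_time f -> a <= b ->
  exists M, 0 <= M /\ forall x t, a <= t <= b -> `|f x t| <= M.
Proof.
move=> fc ab.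
have [x0 [t0 [_ H1]]] := torus_time_min fc ab.
have [x1 [t1 [_ H2]]] := torus_time_min (continuous_torus_timeN fc) ab.
exists (`|f x0 t0| + `|f x1 t1|); split => [|x t tab]; first exact: addr_ge0.
have := H1 x t tab; have := H2 x t tab.
have := ler_norm (f x1 t1); have := ler_norm (- f x0 t0); rewrite normrN.
have := normr_ge0 (f x1 t1); have := normr_ge0 (f x0 t0).
rewrite ler_norml; lra.
Qed.

Lemma torus_bounded (R : realType) (n : nat) (u : 'rV[R]_n -> R) :
  torus_continuous u -> exists M, 0 <= M /\ forall x, `|u x| <= M.
Proof.
move=> uc; have [M [M0 H]] := torus_time_bounded (torus_continuous_time uc) (lexx 0).
by exists M; split => // x; apply: (H x 0); rewrite lexx.
Qed.

Lemma torus_min (R : realType) (n : nat) (u : 'rV[R]_n -> R) :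
  torus_continuous u -> exists x0, forall x, u x0 <= u x.
Proof.
move=> uc; have [x0 [t0 [_ H]]] := torus_time_min (torus_continuous_time uc) (lexx 0).
by exists x0 => x; apply: (H x 0); rewrite lexx.
Qed.

Lemma torus_unif_continuous (R : realType) (n : nat) (u : 'rV[R]_n -> R) (e : R) :
  torus_continuous u -> 0 < e ->
  exists2 d : R, 0 < d & forall x y, `|x - y| < d -> `|u x - u y| < e.
Proof.
move=> [uc up] e0.
have /compact_near_coveringP K := @compact_cube R n.
have : \forall d \near 0^'+, [set x : 'rV[R]_n | forall j, `|x 0 j| <= pi] `<=`
    (fun x => forall y, `|x - y| < d -> `|u x - u y| < e).
  apply: (K R (0^'+) (fun d x => forall y, `|x - y| < d -> `|u x - u y| < e)).
  move=> x _.
  have /cvgrPdist_lt /(_ (e / 2)) := uc x.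
  rewrite divr_gt0 // => /(_ isT) /nbhs_ballP [r /= r0 xr].
  exists (ball x (r / 2), [set d | d < r / 2]).
    split => /=; first by apply: nbhsx_ballx; rewrite divr_gt0.
    by apply: nbhs_right_lt; rewrite divr_gt0.
  case=> x' d [/= Hx Hd] y xy.
  have h1 : `|u x - u x'| < e / 2.
    by apply: xr; apply: le_ball Hx; lra.
  have h2 : `|u x - u y| < e / 2.
    apply: xr; rewrite [r]splitr; apply: (ball_triangle Hx).
    by rewrite -ball_normE /=; exact: lt_trans Hd.
  have -> : u x' - u y = (u x - u y) - (u x - u x') by ring.
  by rewrite (le_lt_trans (ler_normB _ _)) //; lra.
move=> /(@filterI _ _ _ _ _ (nbhs_right_gt 0)) /filter_ex [d [/= d0 Hd]].
exists d => // x y xy.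
(* Only [x] is brought into the cube; [y] moves by the same lattice vector, which leaves [x - y]
   unchanged. *)
have [m mP] := torus_reduce x.
rewrite -(torus_periodic_shift m x up) -(torus_periodic_shift m y up).
by apply: Hd => //; rewrite opprD addrACA subrr addr0.
Qed.

Lemma torus_unif_continuous_coord (R : realType) (n : nat) (u : 'rV[R]_n -> R)
  (e : R) : torus_continuous u -> 0 < e ->
  exists2 d : R, 0 < d &
    forall x y : 'rV[R]_n,
      (forall j, `|x 0 j - y 0 j| < d) -> `|u x - u y| < e.
Proof.
move=> uc e0; have [d d0 H] := torus_unif_continuous uc e0.
exists d => // x y xy; apply: H.
rewrite /Num.Def.normr /= mx_normrE; apply: bigmax_lt => // -[i j] _ /=.
by rewrite !mxE (ord1 i).
Qed.

(** A periodic substitute for half the squared distance. Being a trigonometric polynomial, it has an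
    explicit half Laplacian and explicit integrals against the kernels. *)
Definition torus_gap (R : realType) (n : nat) (x y : 'rV[R]_n) : R :=
  \sum_(j < n) (1 - cos (x 0 j - y 0 j)).

Lemma torus_gap_ge0 (R : realType) (n : nat) (x y : 'rV[R]_n) : 0 <= torus_gap x y.
Proof. by apply: sumr_ge0 => j _; rewrite subr_ge0 cos_le1. Qed.

Lemma cosDint (R : realType) (r : R) (z : int) : cos (r + (2 * pi) * z%:~R) = cos r.
Proof.
have pos (i : nat) (s : R) : cos (s + (2 * pi) * i%:R) = cos s.
  elim: i s => [|i IH] s; first by rewrite mulr0 addr0.
  by rewrite -[i.+1%:R]natr1 mulrDr mulr1 addrA mulr_natl cosD2pi -mulr_natl IH.
case: z => i; first exact: pos.
by rewrite NegzE mulrNz mulrN -[LHS](pos i.+1) subrK.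
Qed.

(** Points close modulo the lattice are handled by uniform continuity; for the others the gap is
    bounded below, so a large multiple of it dominates the oscillation [2 * M]. *)
Lemma torus_modulus (R : realType) (n : nat) (u : 'rV[R]_n -> R) (e : R) :
  torus_continuous u -> 0 < e ->
  exists2 C : R, 0 <= C & forall x y, `|u x - u y| <= e + C * torus_gap x y.
Proof.
move=> uc e0.
have [d d0 Hd] := torus_unif_continuous_coord uc e0.
have [M [M0 HM]] := torus_bounded uc.
(* The cap at [pi] keeps [d'] in the range where [cos] decreases, so that a coordinate difference of
   at least [d'] costs at least [1 - cos d']. *)
pose d' := Num.min d pi.
have d'0 : 0 < d' by rewrite lt_min d0 pi_gt0.
have d'pi : d' <= pi by rewrite ge_min lexx orbT.
pose c : R := 1 - cos d'.
have c0 : 0 < c.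
  by rewrite subr_gt0 -cos0 ltr_cos ?in_itv /= ?lexx ?pi_ge0 ?d'pi ?(ltW d'0).
exists (2 * M / c); first by rewrite divr_ge0 ?mulr_ge0 // ltW.
move=> x y.
have [m mP] := torus_reduce (x - y).
have gapE : torus_gap x y = torus_gap (x + torus_shift R m) y.
  by apply: eq_bigr => j _; rewrite !mxE addrAC cosDint.
rewrite gapE -(torus_periodic_shift m x uc.2).
set x' := x + _.
have x'P j : `|x' 0 j - y 0 j| <= pi by have := mP j; rewrite !mxE addrAC.
have [H|/existsNP [j /negP]] := pselect (forall j, `|x' 0 j - y 0 j| < d').
  have /ltW/le_trans : `|u x' - u y| < e.
    by apply: Hd => j; apply: lt_le_trans (H j) _; rewrite ge_min lexx.
  by apply; rewrite lerDl mulr_ge0 ?torus_gap_ge0 // divr_ge0 ?mulr_ge0 // ltW.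
rewrite -leNgt => dj.
have gap_ge : c <= torus_gap x' y.
  rewrite /torus_gap (bigD1 j) //= -[leLHS]addr0 lerD //; last first.
    by apply: sumr_ge0 => i _; rewrite subr_ge0 cos_le1.
  rewrite lerD2l lerN2 -(cos_norm (_ - _)).
  move: dj; rewrite le_eqVlt => /predU1P[->//|dj]; apply: ltW.
  by rewrite ltr_cos ?in_itv /= ?normr_ge0 ?x'P ?d'pi ?(ltW d'0).
have h : `|u x' - u y| <= 2 * M.
  rewrite (le_trans (ler_normB _ _)) //.
  by have := HM x'; have := HM y; lra.
apply: (le_trans h); apply: (@le_trans _ _ (2 * M / c * torus_gap x' y)).
  rewrite -[leLHS](divfK (lt0r_neq0 c0)) ler_wpM2l // divr_ge0 ?mulr_ge0 //.
  exact: ltW.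
by rewrite lerDr ltW.
Qed.

(** * Integration over the torus *)

Lemma torus_continuous_cst (R : realType) (n : nat) (c : R) :
  torus_continuous (fun _ : 'rV[R]_n => c).
Proof. by split => //; exact: cst_continuous. Qed.

Lemma torus_continuousD (R : realType) (n : nat) (u w : 'rV[R]_n -> R) :
  torus_continuous u -> torus_continuous w ->
  torus_continuous (fun x => u x + w x).
Proof.
move=> [uc up] [wc wp]; split => [x|x j]; last by rewrite up wp.
by apply: continuousD; [exact: uc|exact: wc].
Qed.

Lemma torus_continuousM (R : realType) (n : nat) (u w : 'rV[R]_n -> R) :
  torus_continuous u -> torus_continuous w ->
  torus_continuous (fun x => u x * w x).
Proof.
move=> [uc up] [wc wp]; split => [x|x j]; last by rewrite up wp.
by apply: continuousM; [exact: uc|exact: wc].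
Qed.

Lemma torus_continuousZ (R : realType) (n : nat) (c : R) (u : 'rV[R]_n -> R) :
  torus_continuous u -> torus_continuous (fun x => c * u x).
Proof. exact/torus_continuousM/torus_continuous_cst. Qed.

Lemma torus_continuous_sum (R : realType) (n : nat) (I : Type) (r : seq I)
  (u : I -> 'rV[R]_n -> R) : (forall i, torus_continuous (u i)) ->
  torus_continuous (fun x => \sum_(i <- r) u i x).
Proof.
move=> uc; elim: r => [|i r IH].
  by under eq_fun do rewrite big_nil; exact: torus_continuous_cst.
by under eq_fun do rewrite big_cons; exact: torus_continuousD.
Qed.

Lemma torus_continuous_coord (R : realType) (n : nat) (f : R -> R) (j : 'I_n) :
  continuous f -> (forall s, f (s + 2 * pi) = f s) ->
  torus_continuous (fun x : 'rV[R]_n => f (x 0 j)).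
Proof.
move=> fc fp; split => [x|x i].
  by apply: continuous_comp; [exact: coord_continuous|exact: fc].
rewrite !mxE eqxx /=; case: (j == i); first by rewrite mulr1 fp.
by rewrite mulr0 addr0.
Qed.

Lemma torus_continuous_trig (R : realType) (n : nat) (k : 'rV[int]_n) (c : R) :
  torus_continuous (fun x : 'rV[R]_n => cos (freq_dot k x + c)).
Proof.
split => [x|x j]; last by rewrite freq_dotDr freq_dot_deltar addrAC cosDint.
apply: continuous_comp; last exact: continuous_cos.
apply: continuousD; last exact: cst_continuous.
rewrite /freq_dot; apply: (@cvg_big _ _ _ _ _ _ _ (nbhs x)) => [|j _].
  exact: add_continuous.
by apply: continuousM; [exact: cst_continuous|exact: coord_continuous].
Qed.

Lemma torus_continuous_cos (R : realType) (n : nat) (k : 'rV[int]_n) :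
  torus_continuous (fun x : 'rV[R]_n => cos (freq_dot k x)).
Proof.
by have := torus_continuous_trig k (0 : R); under eq_fun do rewrite addr0.
Qed.

Lemma torus_continuous_sin (R : realType) (n : nat) (k : 'rV[int]_n) :
  torus_continuous (fun x : 'rV[R]_n => sin (freq_dot k x)).
Proof.
have := torus_continuous_trig k (- (pi / 2) : R).
by under eq_fun do rewrite cosBpihalf.
Qed.

Lemma torus_continuous_eval (R : realType) (n : nat) (s : seq ('rV[int]_n * (R * R))) :
  torus_continuous (trig_eval s).
Proof.
apply: torus_continuous_sum => t; apply: torus_continuousD; apply: torus_continuousZ.
  exact: torus_continuous_cos.
exact: torus_continuous_sin.
Qed.

Lemma unif_continuous_coordP (R : realType) (n : nat) (u : 'rV[R]_n -> R) :
  (forall e, 0 < e -> exists2 d : R, 0 < d &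
    forall x y : 'rV[R]_n, (forall j, `|x 0 j - y 0 j| < d) -> `|u x - u y| < e) ->
  continuous u.
Proof.
move=> H x; apply/(@cvgrPdist_lt _ R _ _ (fmap_filter _ (nbhs_filter x))) => e e0.
have [d d0 Hd] := H _ e0.
near=> y; apply: Hd => j.
have : `|x - y| < d by near: y; exact: cvgr_dist_lt.
apply: le_lt_trans; rewrite /Num.Def.normr /= mx_normrE.
rewrite (le_trans _ (le_bigmax _ _ (ord0, j))) //= !mxE //.
Unshelve. all: by end_near. Qed.

Lemma row_cons0 (R : realType) (n : nat) (s : R) (x : 'rV[R]_n) :
  row_mx (s%:M : 'rV[R]_1) x 0 (ord0 : 'I_n.+1) = s.
Proof.
rewrite (_ : ord0 = lshift n (0 : 'I_1)); last exact: val_inj.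
by rewrite row_mxEl mxE eqxx.
Qed.

Lemma row_consS (R : realType) (n : nat) (s : R) (x : 'rV[R]_n) (j : 'I_n) :
  row_mx (s%:M : 'rV[R]_1) x 0 (lift (ord0 : 'I_n.+1) j) = x 0 j.
Proof.
rewrite (_ : lift ord0 j = rshift 1 j); last exact: val_inj.
by rewrite row_mxEr.
Qed.

Lemma row_consP (R : realType) (n : nat) (x y : 'rV[R]_n.+1) :
  x 0 ord0 = y 0 ord0 -> (forall j, x 0 (lift ord0 j) = y 0 (lift ord0 j)) ->
  x = y.
Proof. by move=> h0 h; apply/rowP => j; case: (unliftP ord0 j) => [i|] ->. Qed.

Lemma torus_continuous_slice (R : realType) (n : nat) (u : 'rV[R]_n.+1 -> R)
  (s : R) : torus_continuous u ->
  torus_continuous (fun x : 'rV[R]_n => u (row_mx (s%:M : 'rV[R]_1) x)).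
Proof.
move=> uc; split.
  apply: unif_continuous_coordP => e e0.
  have [d d0 Hd] := torus_unif_continuous_coord uc e0.
  exists d => // x y xy; apply: Hd => j.
  case: (unliftP ord0 j) => [i|] ->; rewrite ?row_consS ?row_cons0 //.
  by rewrite subrr normr0.
move=> x j; rewrite -[RHS](uc.2 _ (lift ord0 j)); congr u.
apply: row_consP => [|i]; rewrite [RHS]mxE.
  by rewrite !row_cons0 !mxE mulr0 addr0.
by rewrite !row_consS !mxE (inj_eq lift_inj).
Qed.

Lemma integrable_period (R : realType) (f : R -> R) : continuous f ->
  (@lebesgue_measure R).-integrable `[0, 2 * pi[%classic (EFin \o f).
Proof.
move=> fc.
have H : (@lebesgue_measure R).-integrable `[0, 2 * pi]%classic (EFin \o f).
  apply: continuous_compact_integrable; first exact: segment_compact.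
  exact: continuous_subspaceT.
apply: integrableS H => //.
by apply: subset_itvl; rewrite bnd_simp.
Qed.

Lemma Rintegral_period_cst (R : realType) (c : R) :
  \int[@lebesgue_measure R]_(s in `[0, 2 * pi[) c = c * (2 * pi).
Proof.
have p0 : 0 < 2 * pi :> R by rewrite mulr_gt0 // pi_gt0.
by rewrite Rintegral_cst //= lebesgue_measure_itv /= lte_fin p0 /= subr0.
Qed.

(** The four facts share one induction: the outer integral requires the inner one to be continuous
    in [s], and that continuity uses additivity, monotonicity and the value on constants one
    dimension lower. *)
Lemma torus_integral_linear (R : realType) (n : nat) :
  [/\ forall u w : 'rV[R]_n -> R, torus_continuous u -> torus_continuous w ->
        torus_integral (fun x => u x + w x) = torus_integral u + torus_integral w,
      forall c (u : 'rV[R]_n -> R), torus_continuous u ->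
        torus_integral (fun x => c * u x) = c * torus_integral u,
      forall u w : 'rV[R]_n -> R, torus_continuous u -> torus_continuous w ->
        (forall x, u x <= w x) -> torus_integral u <= torus_integral w &
      forall c, torus_integral (fun _ : 'rV[R]_n => c) = c * (2 * pi) ^+ n].
Proof.
elim: n => [|n [IHD IHZ IHle IHc]].
  by split => [|||c] //=; rewrite mulr1.
have slice_cont (u : 'rV[R]_n.+1 -> R) : torus_continuous u ->
    continuous (fun s => torus_integral (fun x => u (row_mx (s%:M : 'rV[R]_1) x))).
  move=> uc s; apply/cvgrPdist_le => e e0.
  pose P : R := (2 * pi) ^+ n.
  have P0 : 0 < P by rewrite exprn_gt0 // mulr_gt0 // pi_gt0.
  have [d d0 Hd] := torus_unif_continuous_coord uc (divr_gt0 e0 P0).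
  near=> t.
  have st : `|s - t| < d by near: t; exact: cvgr_dist_lt.
  have close x : `|u (row_mx (s%:M : 'rV[R]_1) x) - u (row_mx (t%:M : 'rV[R]_1) x)|
      < e / P.
    apply: Hd => j; case: (unliftP ord0 j) => [i|] ->;
      rewrite ?row_consS ?row_cons0 //.
    by rewrite subrr normr0.
  have half (p q : R) : (forall x, `|u (row_mx (p%:M : 'rV[R]_1) x) -
        u (row_mx (q%:M : 'rV[R]_1) x)| < e / P) ->
      torus_integral (fun x => u (row_mx (p%:M : 'rV[R]_1) x)) <=
      torus_integral (fun x => u (row_mx (q%:M : 'rV[R]_1) x)) + e.
    move=> pq; rewrite -[X in _ + X](divfK (lt0r_neq0 P0)) -IHc -IHD; last 2 first.
      exact: torus_continuous_slice.
      exact: torus_continuous_cst.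
    apply: IHle; [exact: torus_continuous_slice| |].
      by apply: torus_continuousD; [exact: torus_continuous_slice|
        exact: torus_continuous_cst].
    by move=> x; have := pq x; rewrite ltr_norml => /andP[_]; lra.
  rewrite ler_norml; have := half s t close.
  have : forall x, `|u (row_mx (t%:M : 'rV[R]_1) x) -
      u (row_mx (s%:M : 'rV[R]_1) x)| < e / P by move=> x; rewrite distrC.
  move=> /half; lra.
split => /=.
- move=> u w uc wc; rewrite -RintegralD //; try exact/integrable_period/slice_cont.
  by apply: eq_Rintegral => s _; rewrite IHD //; exact: torus_continuous_slice.
- move=> c u uc; rewrite -RintegralZl //; last exact/integrable_period/slice_cont.
  by apply: eq_Rintegral => s _; rewrite IHZ //; exact: torus_continuous_slice.
- move=> u w uc wc uw; apply: le_Rintegral => //;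
    try exact/integrable_period/slice_cont.
  by move=> s _; apply: IHle => //; exact: torus_continuous_slice.
- move=> c; under eq_Rintegral do rewrite IHc.
  by rewrite Rintegral_period_cst exprSr -mulrA.
Unshelve. all: by end_near. Qed.

Lemma torus_integralD (R : realType) (n : nat) (u w : 'rV[R]_n -> R) :
  torus_continuous u -> torus_continuous w ->
  torus_integral (fun x => u x + w x) = torus_integral u + torus_integral w.
Proof. by have [+ _ _ _] := torus_integral_linear R n; exact. Qed.

Lemma torus_integralZ (R : realType) (n : nat) (c : R) (u : 'rV[R]_n -> R) :
  torus_continuous u ->
  torus_integral (fun x => c * u x) = c * torus_integral u.
Proof. by have [_ + _ _] := torus_integral_linear R n; exact. Qed.

Lemma torus_integral_le (R : realType) (n : nat) (u w : 'rV[R]_n -> R) :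
  torus_continuous u -> torus_continuous w -> (forall x, u x <= w x) ->
  torus_integral u <= torus_integral w.
Proof. by have [_ _ + _] := torus_integral_linear R n; exact. Qed.

Lemma torus_integral_cst (R : realType) (n : nat) (c : R) :
  torus_integral (fun _ : 'rV[R]_n => c) = c * (2 * pi) ^+ n.
Proof. by have [_ _ _ +] := torus_integral_linear R n; exact. Qed.

Lemma torus_integral_sum (R : realType) (n : nat) (I : Type) (r : seq I)
  (u : I -> 'rV[R]_n -> R) : (forall i, torus_continuous (u i)) ->
  torus_integral (fun x => \sum_(i <- r) u i x) =
  \sum_(i <- r) torus_integral (u i).
Proof.
move=> uc; elim: r => [|i r IH].
  under [in LHS]eq_fun do rewrite big_nil.
  by rewrite big_nil torus_integral_cst mul0r.
under [in LHS]eq_fun do rewrite big_cons.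
by rewrite big_cons torus_integralD ?IH //; exact: torus_continuous_sum.
Qed.

Lemma torus_integral_prod (R : realType) (n : nat) (f : 'I_n -> R -> R) :
  (forall j, continuous (f j)) -> (forall j s, f j (s + 2 * pi) = f j s) ->
  torus_integral (fun x : 'rV[R]_n => \prod_j f j (x 0 j)) =
  \prod_j \int[@lebesgue_measure R]_(s in `[0, 2 * pi[) f j s.
Proof.
elim: n f => [|n IH] f fc fp; first by rewrite /= !big_ord0.
rewrite big_ord_recl -(IH (fun j => f (lift ord0 j))) //= -RintegralZr //; last first.
  exact: integrable_period.
apply: eq_Rintegral => s _.
rewrite -torus_integralZ; last first.
  elim: (index_enum _) => [|j r IHr].
    by under eq_fun do rewrite big_nil; exact: torus_continuous_cst.
  under eq_fun do rewrite big_cons; apply: torus_continuousM => //.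
  exact: torus_continuous_coord.
congr torus_integral; apply/funext => x; rewrite big_ord_recl row_cons0.
by congr (_ * _); apply: eq_bigr => j _; rewrite row_consS.
Qed.

Lemma Rintegral_period_FTC (R : realType) (F f : R -> R) :
  (forall s, is_derive s (1 : R) F (f s)) -> continuous f -> F (2 * pi) = F 0 ->
  \int[@lebesgue_measure R]_(s in `[0, 2 * pi[) f s = 0.
Proof.
move=> Ff fc Fp; rewrite Rintegral_itv_bndo_bndc; last exact: integrable_period.
have p0 : 0 < 2 * pi :> R by rewrite mulr_gt0 // pi_gt0.
have Fc : continuous F.
  by move=> s; apply: differentiable_continuous; apply/derivable1_diffP; case: (Ff s).
rewrite /Rintegral (@continuous_FTC2 _ _ F) //.
- by rewrite Fp -EFinB subrr.
- exact: continuous_subspaceT.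
- split.
  + by move=> s _; case: (Ff s).
  + by apply: cvg_at_right_filter; exact: Fc.
  + by apply: cvg_at_left_filter; exact: Fc.
- by move=> s _; rewrite derive1E; case: (Ff s).
Qed.

Lemma continuous_cos_affine (R : realType) (a c : R) :
  continuous (fun s : R => cos (a * s + c)).
Proof.
move=> s; apply: continuous_comp; last exact: continuous_cos.
apply: continuousD; last exact: cst_continuous.
by apply: continuousM; [exact: cst_continuous|exact: id].
Qed.

(** The phase [c] is arbitrary so that the induction can absorb the first coordinate into it. When
    the remaining frequencies vanish, the first one does not, and the integrand has a periodic
    antiderivative. *)
Lemma torus_integral_trig (R : realType) (n : nat) (k : 'rV[int]_n) (c : R) :
  torus_integral (fun x => cos (freq_dot k x + c)) =
  if k == 0 then cos c * (2 * pi) ^+ n else 0.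
Proof.
have [->|k0] := eqVneq k 0.
  under eq_fun do rewrite freq_dot0l add0r.
  exact: torus_integral_cst.
elim: n k k0 c => [|n IH] k k0 c.
  by case/eqP: k0; apply/rowP => -[].
pose k' : 'rV[int]_n := \row_j k 0 (lift ord0 j).
have dotE (s : R) (x : 'rV[R]_n) : freq_dot k (row_mx (s%:M : 'rV[R]_1) x) =
    (k 0 ord0)%:~R * s + freq_dot k' x.
  rewrite /freq_dot big_ord_recl row_cons0; congr (_ + _).
  by apply: eq_bigr => j _; rewrite row_consS mxE.
rewrite /=; under eq_Rintegral => s _.
  under eq_fun do rewrite dotE addrAC addrC.
  over.
have [k'0|k'0] := eqVneq k' 0; last first.
  under eq_Rintegral do rewrite IH //.
  by rewrite Rintegral_period_cst mul0r.
have k00 : (k 0 ord0)%:~R != 0 :> R.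
  rewrite intr_eq0; apply: contraNneq k0 => k00; apply/eqP/rowP => j.
  rewrite mxE; case: (unliftP ord0 j) => [i|] -> //.
  by move/rowP/(_ i): k'0; rewrite !mxE.
under eq_Rintegral => s _.
  under eq_fun do rewrite k'0 freq_dot0l add0r.
  rewrite torus_integral_cst; over.
apply: (@Rintegral_period_FTC _ (fun s => sin ((k 0 ord0)%:~R * s + c) /
    (k 0 ord0)%:~R * (2 * pi) ^+ n)).
- move=> s; apply: is_derive_eq; rewrite /GRing.scale /=.
  by field.
- suff : continuous (fun s : R => cos ((k 0 ord0)%:~R * s + c) * (2 * pi) ^+ n).
    exact.
  by move=> s; apply: cvgM; [exact: continuous_cos_affine|exact: cvg_cst].
- congr (_ / _ * _); rewrite mulr0 add0r -!cosBpihalf.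
  by rewrite [_ * (2 * pi)]mulrC -addrA addrC cosDint.
Qed.

Definition trig_mean (R : realType) (n : nat)
    (s : seq ('rV[int]_n * (R * R))) : R :=
  \sum_(t <- s | t.1 == 0) t.2.1.

Lemma torus_integral_eval (R : realType) (n : nat)
  (s : seq ('rV[int]_n * (R * R))) :
  torus_integral (trig_eval s) = trig_mean s * (2 * pi) ^+ n.
Proof.
have cosc := @torus_continuous_cos R n.
have sinc := @torus_continuous_sin R n.
have cosi (k : 'rV[int]_n) : torus_integral (fun x : 'rV[R]_n => cos (freq_dot k x)) =
    if k == 0 then (2 * pi) ^+ n else 0.
  by have := torus_integral_trig k (0 : R); under eq_fun do rewrite addr0;
    rewrite cos0 mul1r.
have sini (k : 'rV[int]_n) :
    torus_integral (fun x : 'rV[R]_n => sin (freq_dot k x)) = 0.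
  have := torus_integral_trig k (- (pi / 2) : R).
  under eq_fun do rewrite cosBpihalf.
  by rewrite cosN cos_pihalf mul0r if_same.
rewrite torus_integral_sum => [|t]; last first.
  by apply: torus_continuousD; exact: torus_continuousZ.
rewrite /trig_mean mulr_suml [RHS]big_mkcond; apply: eq_bigr => t _.
rewrite torus_integralD ?torus_integralZ //; try exact: torus_continuousZ.
by rewrite sini cosi mulr0 addr0; case: eqP; rewrite ?mulr0.
Qed.

(** * Powers of the raised cosine and their integrals *)

Definition bump (R : realType) (N : nat) (s : R) : R := ((1 + cos s) / 2) ^+ N.

Lemma bump_ge0 (R : realType) (N : nat) (s : R) : 0 <= bump N s.
Proof. by apply: exprn_ge0; have := cos_geN1 s; lra. Qed.

Lemma bump_le1 (R : realType) (N : nat) (s : R) : bump N s <= 1.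
Proof. by apply: exprn_ile1; have := cos_geN1 s; have := cos_le1 s; lra. Qed.

(** With [bump N s = cos(s/2)^(2N)], this trades the weight [1 - cos s] for consecutive powers, so
    the mean gap of a kernel follows from the masses alone. *)
Lemma bumpS (R : realType) (N : nat) (s : R) :
  (1 - cos s) * bump N s = 2 * bump N s + (- 2) * bump N.+1 s.
Proof. by rewrite /bump exprS; field. Qed.

Lemma bumpD2pi (R : realType) (N : nat) (a s : R) :
  bump N (s + 2 * pi - a) = bump N (s - a).
Proof. by rewrite /bump addrAC mulr_natl cosD2pi. Qed.

Lemma continuous_bump (R : realType) (N : nat) (a : R) :
  continuous (fun s : R => bump N (s - a)).
Proof.
move=> s; apply: (@continuous_comp _ _ _ (fun s => (1 + cos (s - a)) / 2)
  (fun r => r ^+ N)); last exact: exprn_continuous.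
apply: cvgM; last exact: cvg_cst.
apply: cvgD; first exact: cvg_cst.
have := @continuous_cos_affine R 1 (- a) s.
by rewrite /continuous_at mul1r; under eq_fun do rewrite mul1r.
Qed.

Lemma bump_integralZ (R : realType) (c : R) (N : nat) (a : R) :
  \int[@lebesgue_measure R]_(s in `[0, 2 * pi[) (c * bump N (s - a)) =
  c * \int[@lebesgue_measure R]_(s in `[0, 2 * pi[) bump N (s - a).
Proof.
by rewrite RintegralZl //; exact/integrable_period/continuous_bump.
Qed.

Lemma bump_integralD (R : realType) (b c : R) (N M : nat) (a : R) :
  \int[@lebesgue_measure R]_(s in `[0, 2 * pi[)
    (b * bump N (s - a) + c * bump M (s - a)) =
  b * \int[@lebesgue_measure R]_(s in `[0, 2 * pi[) bump N (s - a) +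
  c * \int[@lebesgue_measure R]_(s in `[0, 2 * pi[) bump M (s - a).
Proof.
have cc (d : R) K : continuous (fun s : R => d * bump K (s - a)).
  by move=> s; apply: cvgM; [exact: cvg_cst|exact: continuous_bump].
by rewrite RintegralD ?bump_integralZ //; exact/integrable_period/cc.
Qed.

(* Wallis: the derivative of [sin (s - a) ((1 + cos (s - a)) / 2)^N] integrates
   to zero over a period. *)
Lemma bump_integral_rec (R : realType) (N : nat) (a : R) :
  (2 * N%:R + 2) * \int[@lebesgue_measure R]_(s in `[0, 2 * pi[) bump N.+1 (s - a) =
  (2 * N%:R + 1) * \int[@lebesgue_measure R]_(s in `[0, 2 * pi[) bump N (s - a).
Proof.
apply/eqP; rewrite -subr_eq0 -mulNr -bump_integralD; apply/eqP.
have fc : continuous (fun s : R => (2 * N%:R + 2) * bump N.+1 (s - a) +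
    - (2 * N%:R + 1) * bump N (s - a)).
  by move=> s; apply: cvgD; apply: cvgM; first [exact: cvg_cst
    |exact: continuous_bump].
apply: (@Rintegral_period_FTC _ (fun s => sin (s - a) * bump N (s - a)) _ _ fc).
- move=> s.
  have D : is_derive s (1 : R) (fun s => (1 + cos (s - a)) / 2) (- sin (s - a) / 2).
    by apply: is_derive_eq; rewrite /GRing.scale /=; field.
  have DX := is_deriveX N D; rewrite exprfctE in DX.
  rewrite /bump; apply: is_derive_eq; rewrite /GRing.scale /=.
  have S2 := sin2cos2 (s - a).
  (* The power rule produces the exponent [N.-1], which is genuine only for positive [N]. *)
  case: N {DX fc} => [|N]; first by rewrite !expr0 expr1 /=; field.
  rewrite /= -[N.+1%:R]natr1 !exprS.
  move: (_ ^+ N) (N%:R : R) => P q.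
  set c := cos (s - a) in S2 *; set t := sin (s - a) in S2 *.
  have -> : t * ((q + 1) * P * (- t / 2)) = - (t ^+ 2) * (q + 1) * P / 2 by field.
  by rewrite S2; field.
- by rewrite -[2 * pi](add0r) bumpD2pi addrAC mulr_natl sinD2pi.
Qed.

(** Independence of the centre [a] comes from the recursion, whose coefficients do not involve [a],
    instead of a change of variables. The value is [2 pi] times [binom(2N, N) / 4^N]. *)
Lemma bump_integralE (R : realType) (N : nat) :
  exists2 c : R, 0 < c &
    forall a, \int[@lebesgue_measure R]_(s in `[0, 2 * pi[) bump N (s - a) = c.
Proof.
elim: N => [|N [c c0 cE]].
  exists (2 * pi) => [|a]; first by rewrite mulr_gt0 // pi_gt0.
  by rewrite /bump; under eq_Rintegral do rewrite expr0;
    rewrite Rintegral_period_cst mul1r.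
have N0 : 0 <= N%:R :> R by rewrite ler0n.
exists ((2 * N%:R + 1) / (2 * N%:R + 2) * c) => [|a].
  by rewrite mulr_gt0 // divr_gt0 //; lra.
by rewrite mulrAC -(cE a) -bump_integral_rec mulrAC divff ?mul1r.
Qed.

(** * Approximation by trigonometric polynomials *)

Definition bump_mass (R : realType) (N : nat) : R :=
  \int[@lebesgue_measure R]_(s in `[0, 2 * pi[) bump N (s - 0).

Lemma bump_massE (R : realType) (N : nat) (a : R) :
  \int[@lebesgue_measure R]_(s in `[0, 2 * pi[) bump N (s - a) = bump_mass R N.
Proof. by have [c _ cE] := bump_integralE R N; rewrite /bump_mass !cE. Qed.

Lemma bump_mass_gt0 (R : realType) (N : nat) : 0 < bump_mass R N.
Proof. by have [c c0 cE] := bump_integralE R N; rewrite /bump_mass cE. Qed.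

Lemma bump_massS (R : realType) (N : nat) :
  2 * bump_mass R N + (- 2) * bump_mass R N.+1 = bump_mass R N / N.+1%:R.
Proof.
have N0 : 0 <= N%:R :> R by rewrite ler0n.
have N2 : 2 * N%:R + 2 != 0 :> R by apply: lt0r_neq0; lra.
apply: (mulfI N2); rewrite mulrDr mulrCA [_ * (-2 * _)]mulrCA.
have := bump_integral_rec N (0 : R); rewrite !bump_massE => ->.
by rewrite -natr1; field; apply/eqP; lra.
Qed.

(** An approximate identity that is nonnegative, is a trigonometric polynomial, and splits over
    coordinates, so that its integrals factor. *)
Definition kernel_bump (R : realType) (n N : nat) (z : 'rV[R]_n) : R :=
  \prod_j (bump N (z 0 j) / bump_mass R N).

Lemma kernel_bump_ge0 (R : realType) (n N : nat) (z : 'rV[R]_n) :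
  0 <= kernel_bump N z.
Proof.
by apply: prodr_ge0 => j _; rewrite divr_ge0 ?bump_ge0 // ltW // bump_mass_gt0.
Qed.

Lemma kernel_bump_le (R : realType) (n N : nat) (z : 'rV[R]_n) :
  kernel_bump N z <= (bump_mass R N)^-1 ^+ n.
Proof.
have m0 := bump_mass_gt0 R N.
rewrite -[n in leRHS]card_ord -prodr_const; apply: ler_prod => j _.
rewrite divr_ge0 ?bump_ge0 ?(ltW m0) //=.
by rewrite -[leRHS]mul1r ler_wpM2r ?bump_le1 // invr_ge0 ltW.
Qed.

Lemma continuous_bump_scaled (R : realType) (N : nat) (c a : R) :
  continuous (fun s : R => bump N (s - a) * c).
Proof. by move=> s; apply: cvgM; [exact: continuous_bump|exact: cvg_cst]. Qed.

Lemma torus_continuous_prod (R : realType) (n : nat) (f : 'I_n -> R -> R) :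
  (forall j, continuous (f j)) -> (forall j s, f j (s + 2 * pi) = f j s) ->
  torus_continuous (fun x : 'rV[R]_n => \prod_j f j (x 0 j)).
Proof.
move=> fc fp; elim: (index_enum _) => [|j r IH].
  by under eq_fun do rewrite big_nil; exact: torus_continuous_cst.
under eq_fun do rewrite big_cons; apply: torus_continuousM => //.
exact: torus_continuous_coord.
Qed.

Lemma torus_continuous_kernel (R : realType) (n N : nat) (x : 'rV[R]_n) :
  torus_continuous (fun y => kernel_bump N (y - x)).
Proof.
rewrite /kernel_bump; under eq_fun do under eq_bigr do rewrite !mxE.
apply: (@torus_continuous_prod _ _ (fun j s => bump N (s - x 0 j) / bump_mass R N)).
  by move=> j; exact: continuous_bump_scaled.
by move=> j s; rewrite bumpD2pi.
Qed.

Lemma torus_integral_kernel (R : realType) (n N : nat) (x : 'rV[R]_n) :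
  torus_integral (fun y => kernel_bump N (y - x)) = 1.
Proof.
rewrite /kernel_bump; under eq_fun do under eq_bigr do rewrite !mxE.
rewrite (@torus_integral_prod _ _ (fun j s => bump N (s - x 0 j) / bump_mass R N));
  first last.
- by move=> j s; rewrite bumpD2pi.
- by move=> j; exact: continuous_bump_scaled.
apply: big1 => j _.
under eq_Rintegral do rewrite mulrC.
by rewrite bump_integralZ bump_massE mulVf // gt_eqF // bump_mass_gt0.
Qed.

Lemma torus_continuous_gap (R : realType) (n : nat) (x : 'rV[R]_n) :
  torus_continuous (fun y => torus_gap y x).
Proof.
apply: torus_continuous_sum => j.
apply: (@torus_continuous_coord _ _ (fun s => 1 - cos (s - x 0 j))) => [s|s].
  apply: cvgD; first exact: cvg_cst.
  have := @continuous_cos_affine R 1 (- x 0 j) s.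
  rewrite /continuous_at mul1r; under eq_fun do rewrite mul1r.
  exact: cvgN.
by rewrite addrAC mulr_natl cosD2pi.
Qed.

(** Each summand of the gap times the kernel is a product over coordinates: by [bumpS] and
    [bump_massS] its own coordinate contributes [1 / (N + 1)], and every other coordinate
    contributes 1. This is the concentration rate of the kernel. *)
Lemma torus_integral_gap_kernel (R : realType) (n N : nat) (x : 'rV[R]_n) :
  torus_integral (fun y => torus_gap y x * kernel_bump N (y - x)) =
  n%:R / N.+1%:R.
Proof.
pose f (j i : 'I_n) (s : R) := (if i == j then 1 - cos (s - x 0 i) else 1) *
  (bump N (s - x 0 i) / bump_mass R N).
have fE j (y : 'rV[R]_n) : \prod_i f j i (y 0 i) =
    (1 - cos (y 0 j - x 0 j)) * kernel_bump N (y - x).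
  rewrite /f big_split /= -big_mkcond /= big_pred1_eq; congr (_ * _).
  by apply: eq_bigr => i _; rewrite !mxE.
have fc j i : continuous (f j i).
  move=> s; apply: cvgM; last exact: continuous_bump_scaled.
  case: (i == j); last exact: cvg_cst.
  apply: cvgD; first exact: cvg_cst.
  have := @continuous_cos_affine R 1 (- x 0 i) s.
  rewrite /continuous_at mul1r; under eq_fun do rewrite mul1r.
  exact: cvgN.
have fp j i s : f j i (s + 2 * pi) = f j i s.
  by rewrite /f bumpD2pi addrAC mulr_natl cosD2pi.
under eq_fun do rewrite /torus_gap mulr_suml.
rewrite torus_integral_sum => [|j]; last first.
  by under eq_fun do rewrite -fE; exact: torus_continuous_prod.
have m0 := lt0r_neq0 (bump_mass_gt0 R N).
rewrite (eq_bigr (fun=> N.+1%:R^-1)) ?sumr_const ?card_ord ?mulr_natl // => j _.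
under eq_fun do rewrite -fE.
rewrite torus_integral_prod // (bigD1 j) //= big1 ?mulr1 => [|i /negbTE ij].
  rewrite /f eqxx.
  have E s : (1 - cos (s - x 0 j)) * (bump N (s - x 0 j) / bump_mass R N) =
      (2 / bump_mass R N) * bump N (s - x 0 j) +
      (- 2 / bump_mass R N) * bump N.+1 (s - x 0 j).
    by rewrite mulrA bumpS; field.
  under eq_Rintegral do rewrite E.
  rewrite bump_integralD !bump_massE.
  apply: (mulfI m0); rewrite -bump_massS mulrDr.
  by field.
rewrite /f ij; under eq_Rintegral do rewrite mul1r mulrC.
by rewrite bump_integralZ bump_massE mulVf.
Qed.

(** A Korovkin argument: integrating the bound of [torus_modulus] against the kernel gives the error
    [e / 2 + C * (n / (N + 1))], uniformly in [x], and [M] makes the second term at most [e / 2]. *)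
Lemma kernel_bump_approx (R : realType) (n : nat) (w : 'rV[R]_n -> R) (e : R) :
  torus_continuous w -> 0 < e -> exists M, forall N, (M <= N)%N -> forall x,
    `|torus_integral (fun y => w y * kernel_bump N (y - x)) - w x| <= e.
Proof.
move=> wc e0.
have e20 : 0 < e / 2 by rewrite divr_gt0.
have [C C0 HC] := torus_modulus wc e20.
pose M := (Num.trunc (C * n%:R / (e / 2))).+1.
exists M => N MN x.
have smallN : C * (n%:R / N.+1%:R) <= e / 2.
  have : C * n%:R / (e / 2) < N.+1%:R.
    apply: lt_le_trans (truncnS_gt _) _; rewrite ler_nat.
    exact: leq_trans MN (leqnSn _).
  rewrite ltr_pdivrMr // => /ltW; rewrite [leRHS]mulrC mulrA => h.
  by rewrite ler_pdivrMr ?ltr0n.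
have kc := torus_continuous_kernel N x.
have gc := torus_continuousM (torus_continuous_gap x) kc.
have bound : torus_integral (fun y => (e / 2) * kernel_bump N (y - x) +
    C * (torus_gap y x * kernel_bump N (y - x))) = e / 2 + C * (n%:R / N.+1%:R).
  rewrite torus_integralD ?torus_integralZ ?torus_integral_kernel //;
    try exact: torus_continuousZ.
  by rewrite torus_integral_gap_kernel mulr1.
move: (C * (n%:R / N.+1%:R)) smallN bound => q qe bound.
have key y : `|w y * kernel_bump N (y - x) - w x * kernel_bump N (y - x)| <=
    (e / 2) * kernel_bump N (y - x) + C * (torus_gap y x * kernel_bump N (y - x)).
  rewrite -mulrBl normrM mulrA -mulrDl (ger0_norm (kernel_bump_ge0 _ _)).
  by rewrite ler_wpM2r ?kernel_bump_ge0.
have bc : torus_continuous (fun y => (e / 2) * kernel_bump N (y - x) +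
    C * (torus_gap y x * kernel_bump N (y - x))).
  by apply: torus_continuousD; exact: torus_continuousZ.
have wkc := torus_continuousM wc kc.
have wxc := torus_continuousZ (w x) kc.
have wxE : torus_integral (fun y => w x * kernel_bump N (y - x)) = w x.
  by rewrite torus_integralZ // torus_integral_kernel mulr1.
rewrite ler_norml; apply/andP; split.
  have : w x <= torus_integral (fun y => w y * kernel_bump N (y - x)) +
      (e / 2 + q).
    rewrite -{1}wxE -bound -torus_integralD //.
    apply: torus_integral_le => //; first exact: torus_continuousD.
    by move=> y; have := key y; rewrite ler_norml; lra.
  lra.
have : torus_integral (fun y => w y * kernel_bump N (y - x)) <=
    w x + (e / 2 + q).
  rewrite -{1}wxE -bound -torus_integralD //.
  apply: torus_integral_le => //; first exact: torus_continuousD.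
  by move=> y; have := key y; rewrite ler_norml; lra.
lra.
Qed.

(** The kernel centred at [y] is bounded by a constant [B], so [B] times the integral of [w]
    dominates a local average of [w] that exceeds or equals [w y / 2]. *)
Lemma torus_integral_gt0 (R : realType) (n : nat) (w : 'rV[R]_n -> R)
  (y : 'rV[R]_n) : torus_continuous w -> (forall x, 0 <= w x) -> 0 < w y ->
  0 < torus_integral w.
Proof.
move=> wc w0 wy; have wy2 : 0 < w y / 2 by rewrite divr_gt0.
have [M /(_ M (leqnn _) y)] := kernel_bump_approx wc wy2.
set B := (bump_mass R M)^-1 ^+ n.
have B0 : 0 < B by rewrite exprn_gt0 // invr_gt0 bump_mass_gt0.
have : torus_integral (fun x => w x * kernel_bump M (x - y)) <= B * torus_integral w.
  rewrite -torus_integralZ //; apply: torus_integral_le.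
  - exact/torus_continuousM/torus_continuous_kernel.
  - exact: torus_continuousZ.
  by move=> x; rewrite mulrC ler_wpM2r // kernel_bump_le.
rewrite ler_norml => h1 /andP[h2 _].
rewrite -(pmulr_rgt0 _ B0); lra.
Qed.

(** Cosines alone suffice for an even kernel, and they are closed under products by the
    product-to-sum formula. *)
Definition cosine_sum (R : realType) (n : nat) (f : 'rV[R]_n -> R) : Prop :=
  exists r : seq ('rV[int]_n * R),
    forall z, f z = \sum_(t <- r) t.2 * cos (freq_dot t.1 z).

Lemma cosine_sum_cst (R : realType) (n : nat) (c : R) :
  cosine_sum (fun _ : 'rV[R]_n => c).
Proof.
by exists [:: (0, c)] => z; rewrite big_seq1 freq_dot0l cos0 mulr1.
Qed.

Lemma cosine_sumM (R : realType) (n : nat) (f g : 'rV[R]_n -> R) :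
  cosine_sum f -> cosine_sum g -> cosine_sum (fun z => f z * g z).
Proof.
move=> [r fE] [q gE].
exists (flatten [seq [:: (p.1.1 + p.2.1, p.1.2 * p.2.2 / 2);
  (p.1.1 - p.2.1, p.1.2 * p.2.2 / 2)] | p <- [seq (a, b) | a <- r, b <- q]]) => z.
rewrite fE gE big_flatten big_map big_allpairs_dep mulr_suml.
apply: eq_bigr => a _; rewrite mulr_sumr; apply: eq_bigr => b _ /=.
rewrite big_cons big_seq1 /= !freq_dotDl freq_dotNl cosD cosB.
by field.
Qed.

Lemma cosine_sum_kernel (R : realType) (n N : nat) :
  cosine_sum (@kernel_bump R n N).
Proof.
rewrite /kernel_bump.
have prod (I : Type) (r : seq I) (f : I -> 'rV[R]_n -> R) :
    (forall i, cosine_sum (f i)) -> cosine_sum (fun z => \prod_(i <- r) f i z).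
  move=> fc; elim: r => [|i r IH].
    by under eq_fun do rewrite big_nil; exact: cosine_sum_cst.
  by under eq_fun do rewrite big_cons; exact: cosine_sumM.
apply: prod => j; apply: cosine_sumM; last exact: cosine_sum_cst.
rewrite /bump; elim: N => [|N IH].
  by under eq_fun do rewrite expr0; exact: cosine_sum_cst.
under eq_fun do rewrite exprS; apply: cosine_sumM => //.
exists [:: (0, 1 / 2); (delta_mx 0 j, 1 / 2)] => z.
rewrite big_cons big_seq1 /= freq_dot0l freq_dot_deltal cos0.
by field.
Qed.

(** The same polynomial must serve both bounds: this is what lets a pointwise inequality for [|k|]
    on polynomials pass to the limit. The relation is stable under linear combinations. *)
Definition trig_approx (R : realType) (n : nat) (u v : 'rV[R]_n -> R) : Prop :=
  forall e : R, 0 < e -> exists s : seq ('rV[int]_n * (R * R)), forall x,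
    `|u x - trig_eval s x| <= e /\
    `|v x - trig_eval (trig_mul (freq_norm R (n := n)) s) x| <= e.

(** Convolution with the kernel turns [u] and [v] into trigonometric polynomials and commutes with
    [|k|]. Taking [N] as a maximum makes one kernel good for both functions. *)
Lemma half_laplacian_trig_approx (R : realType) (n : nat) (u v : 'rV[R]_n -> R) :
  torus_continuous u -> torus_continuous v -> is_half_laplacian u v ->
  trig_approx u v.
Proof.
move=> uc vc uv e e0.
have [M1 H1] := kernel_bump_approx uc e0.
have [M2 H2] := kernel_bump_approx vc e0.
pose N := maxn M1 M2.
have [r rE] := cosine_sum_kernel R n N.
pose cc (w : 'rV[R]_n -> R) k := torus_integral (fun y => w y * cos (freq_dot k y)).
pose cs (w : 'rV[R]_n -> R) k := torus_integral (fun y => w y * sin (freq_dot k y)).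
have cosc := @torus_continuous_cos R n.
have sinc := @torus_continuous_sin R n.
have conv w x : torus_continuous w ->
    torus_integral (fun y => w y * kernel_bump N (y - x)) =
    \sum_(t <- r) t.2 * (cc w t.1 * cos (freq_dot t.1 x) +
      cs w t.1 * sin (freq_dot t.1 x)).
  move=> wc.
  have E y : w y * kernel_bump N (y - x) = \sum_(t <- r)
      (t.2 * cos (freq_dot t.1 x) * (w y * cos (freq_dot t.1 y)) +
       t.2 * sin (freq_dot t.1 x) * (w y * sin (freq_dot t.1 y))).
    rewrite rE mulr_sumr; apply: eq_bigr => t _.
    by rewrite freq_dotDr freq_dotNr cosB; ring.
  under eq_fun do rewrite E.
  have wcos k := torus_continuousM wc (cosc k).
  have wsin k := torus_continuousM wc (sinc k).
  rewrite torus_integral_sum => [|t]; last first.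
    by apply: torus_continuousD; exact: torus_continuousZ.
  apply: eq_bigr => t _.
  rewrite torus_integralD ?torus_integralZ //; try exact: torus_continuousZ.
  by rewrite -/(cc w t.1) -/(cs w t.1); ring.
exists [seq (t.1, (t.2 * cc u t.1, t.2 * cs u t.1)) | t <- r] => x; split.
  rewrite distrC /trig_eval big_map.
  have := H1 N (leq_maxl _ _) x; rewrite conv //.
  set S1 := \sum_(t <- r) _; set S2 := \sum_(t <- r) _.
  suff -> : S1 = S2 by [].
  by apply: eq_bigr => t _ /=; rewrite mulrDr !mulrA.
rewrite distrC trig_mulE big_map.
have := H2 N (leq_maxr _ _) x; rewrite conv //.
set S1 := \sum_(t <- r) _; set S2 := \sum_(t <- r) _.
suff -> : S1 = S2 by [].
apply: eq_bigr => t _ /=.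
have P0 : (2 * pi) ^+ n != 0 :> R.
  by apply: lt0r_neq0; rewrite exprn_gt0 // mulr_gt0 // pi_gt0.
have := uv t.1; rewrite /fourier_coef; simpc.
rewrite -/(cc u t.1) -/(cs u t.1) -/(cc v t.1) -/(cs v t.1).
rewrite !mulrA => -[/(mulIf (invr_neq0 P0)) -> /oppr_inj].
by move=> /(mulIf (invr_neq0 P0)) ->; ring.
Qed.

(** * Maximum and comparison principles *)

(** The constant part [n] is annihilated by [|k|], and the remaining frequencies are unit vectors,
    on which [|k|] acts as the identity. *)
Lemma trig_gap (R : realType) (n : nat) (x0 : 'rV[R]_n) :
  exists s : seq ('rV[int]_n * (R * R)), forall x,
    trig_eval s x = torus_gap x x0 /\
    trig_eval (trig_mul (freq_norm R (n := n)) s) x = torus_gap x x0 - n%:R.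
Proof.
pose t (j : 'I_n) : seq ('rV[int]_n * (R * R)) :=
  [:: (0, (1, 0)); (delta_mx 0 j, (- cos (x0 0 j), - sin (x0 0 j)))].
exists (flatten [seq t j | j <- enum 'I_n]) => x; split.
  rewrite /trig_eval big_flatten big_map big_enum; apply: eq_bigr => j _ /=.
  rewrite big_cons big_seq1 /= freq_dot0l freq_dot_deltal cos0 sin0 cosB.
  by ring.
rewrite trig_mulE big_flatten big_map big_enum /=.
rewrite (eq_bigr (fun j => (1 - cos (x 0 j - x0 0 j)) - 1)) => [|j _].
  by rewrite sumrB sumr_const card_ord.
rewrite big_cons big_seq1 /= freq_norm0 freq_norm_delta freq_dot_deltal cosB.
by ring.
Qed.

Lemma trig_approx_eval (R : realType) (n : nat) (s : seq ('rV[int]_n * (R * R))) :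
  trig_approx (trig_eval s) (trig_eval (trig_mul (freq_norm R (n := n)) s)).
Proof. by move=> e e0; exists s => x; rewrite !subrr normr0 ltW. Qed.

Lemma trig_approxZ (R : realType) (n : nat) (c : R) (u v : 'rV[R]_n -> R) :
  trig_approx u v -> trig_approx (fun x => c * u x) (fun x => c * v x).
Proof.
move=> uv e e0.
have c0 : 0 < `|c| + 1 by rewrite ltr_wpDl.
have [s sP] := uv _ (divr_gt0 e0 c0).
have bound r : `|r| <= e / (`|c| + 1) -> `|c * r| <= e.
  move=> re; rewrite normrM (@le_trans _ _ ((`|c| + 1) * `|r|)) //.
    by rewrite ler_wpM2r // lerDl.
  by rewrite mulrC -ler_pdivlMr.
exists (trig_mul (fun=> c) s) => x; have [h1 h2] := sP x.
rewrite trig_eval_scale trig_mul_comp; split.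
  by rewrite -mulrBr bound.
rewrite (_ : trig_eval _ x = c * trig_eval (trig_mul (freq_norm R (n := n)) s) x).
  by rewrite -mulrBr bound.
rewrite -trig_eval_scale trig_mul_comp; congr trig_eval; congr trig_mul.
by apply/funext => k; rewrite mulrC.
Qed.

Lemma trig_approxD (R : realType) (n : nat) (u1 v1 u2 v2 : 'rV[R]_n -> R) :
  trig_approx u1 v1 -> trig_approx u2 v2 ->
  trig_approx (fun x => u1 x + u2 x) (fun x => v1 x + v2 x).
Proof.
move=> uv1 uv2 e e0; have e20 : 0 < e / 2 by rewrite divr_gt0.
have [s1 sP1] := uv1 _ e20; have [s2 sP2] := uv2 _ e20.
exists (s1 ++ s2) => x; rewrite trig_mul_cat !trig_eval_cat.
have [+ +] := sP1 x; have [+ +] := sP2 x; rewrite !ler_norml => *; split; lra.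
Qed.

(* Perturbing [u] by a small multiple of [torus_gap x x0] forces the minima of
   the approximating trigonometric polynomials to stay close to [x0]. *)
Lemma half_laplacian_min_le0 (R : realType) (n : nat) (u v : 'rV[R]_n -> R)
  (x0 : 'rV[R]_n) : torus_continuous v -> trig_approx u v ->
  (forall x, u x0 <= u x) -> v x0 <= 0.
Proof.
move=> vc uv umin; rewrite leNgt; apply/negP => d0.
set d := v x0 in d0.
(* The half Laplacian of [eta * torus_gap] is at least [- eta * n], hence at least [- d / 4]. *)
pose eta : R := d / (4 * n.+1%:R).
have n0 : 0 <= n%:R :> R by rewrite ler0n.
have eta0 : 0 < eta by rewrite divr_gt0 // mulr_gt0 // ltr0n.
have etan : eta * n%:R <= d / 4.
  rewrite /eta -[n.+1%:R]natr1 mulrAC ler_pdivrMr; last lra.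
  have -> : d / 4 * (4 * (n%:R + 1)) = d * n%:R + d by field.
  by rewrite lerDl ltW.
have d40 : 0 < d / 4 by rewrite divr_gt0.
have [C C0 HC] := torus_modulus vc d40.
(* The first bound controls the approximation of [v]; the second makes [C] times the gap between
   [x1] and [x0] at most [d / 8]. *)
pose e : R := Num.min (d / 8) (d * eta / (16 * (C + 1))).
have e0 : 0 < e.
  by rewrite lt_min !divr_gt0 ?mulr_gt0 //; lra.
have e1 : e <= d / 8 by rewrite ge_min lexx.
have e2 : 16 * (C + 1) * e <= d * eta.
  by rewrite mulrC -ler_pdivlMr ?ge_min ?lexx ?orbT //; lra.
have [s sP] := uv _ e0.
have [t tP] := trig_gap x0.
have [x1 x1min] := torus_min (torus_continuous_eval (s ++ trig_mul (fun=> eta) t)).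
have := trig_half_laplacian_le0 x1min.
have := x1min x0.
rewrite trig_mul_cat !trig_eval_cat !trig_eval_scale trig_mul_comp.
have -> : trig_eval (trig_mul (fun k => freq_norm R k * eta) t) x1 =
    eta * trig_eval (trig_mul (freq_norm R (n := n)) t) x1.
  rewrite -trig_eval_scale trig_mul_comp; congr trig_eval; congr trig_mul.
  by apply/funext => k; rewrite mulrC.
have [-> ->] := tP x1; have [-> _] := tP x0.
have -> : torus_gap x0 x0 = 0.
  by rewrite /torus_gap big1 // => j _; rewrite subrr cos0 subrr.
have [+ _] := sP x0; have [+ +] := sP x1.
have := HC x1 x0; have := torus_gap_ge0 x1 x0; have := umin x1.
rewrite !ler_norml -/d.
move: (torus_gap x1 x0) (trig_eval s x1) (trig_eval s x0) (trig_eval (trig_mul _ s) x1)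
  (u x1) (u x0) (v x1) => G S1 S0 L U1 U0 V1.
move=> hU G0 /andP[hV _] /andP[h1 h2] /andP[h3 h4] /andP[h5 h6] h7 h8.
(* Comparing the perturbed polynomial at [x1] and [x0] bounds the gap [G]. The modulus then forces
   [V1 >= 5 d / 8], while the principle for polynomials gives [V1 <= 3 d / 8]. *)
have hG : eta * G <= 2 * e by lra.
have hL : L <= d / 4 by nra.
have hCG : C * G <= d / 8.
  rewrite -(ler_pM2l eta0).
  have : C * (eta * G) <= C * (2 * e) by rewrite ler_wpM2l.
  nra.
lra.
Qed.

Lemma is_derive_gt0_left (R : realType) (f : R -> R) (a t d : R) :
  is_derive t 1 f d -> 0 < d -> a < t -> exists2 r, a <= r < t & f r < f t.
Proof.
move=> [fd fE] d0 at0.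
have C : (h^-1 *: (f (h *: 1 + t) - f t)) @[h --> 0^'] --> d.
  by rewrite -fE; exact: fd.
have /nbhs_ballP [r /= r0 rP] : \forall h \near 0^', 0 < h^-1 *: (f (h *: 1 + t) - f t).
  by apply: (cvgr_gt d).
pose h := Num.min (r / 2) (t - a).
have h0 : 0 < h by rewrite lt_min divr_gt0 // subr_gt0.
have hr : h <= r / 2 by rewrite ge_min lexx.
have ha : h <= t - a by rewrite ge_min lexx orbT.
exists (t - h); first by apply/andP; split; lra.
have : ball 0 r (- h).
  by rewrite -ball_normE /= sub0r opprK gtr0_norm //; lra.
move=> /rP /(_ _); rewrite oppr_eq0 gt_eqF // => /(_ isT).
rewrite /GRing.scale /= mulr1 invrN mulNr -mulrN opprB pmulr_rgt0 ?invr_gt0 //.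
by rewrite subr_gt0 addrC.
Qed.

(* [l] plays the role of [(-Delta)^(1/2) w], in the sense of simultaneous
   uniform approximation. *)
Definition half_laplacian_flow (R : realType) (n : nat)
    (w wt l : 'rV[R]_n -> R -> R) : Prop :=
  [/\ continuous_torus_time w,
      (forall x t, is_derive t (1 : R) (w x) (wt x t)),
      (forall t, torus_continuous (fun x => l x t)) &
      (forall t, trig_approx (fun x => w x t) (fun x => l x t))].

(* At a negative minimum of [e^(-(K+1)t) w] the half Laplacian has the good
   sign, and the exponential factor makes the time derivative positive. *)
Lemma half_laplacian_comparison (R : realType) (n : nat)
  (w wt l : 'rV[R]_n -> R -> R) (K a : R) :
  half_laplacian_flow w wt l ->
  (forall x t, a <= t -> w x t < 0 -> - l x t + K * w x t <= wt x t) ->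
  (forall x, 0 <= w x a) -> forall x t, a <= t -> 0 <= w x t.
Proof.
move=> [wc wd lc wl] weq wa y b ab; rewrite leNgt; apply/negP => wyb.
pose E (t : R) := expR (- (K + 1) * t).
pose z (x : 'rV[R]_n) (t : R) := E t * w x t.
have E0 t : 0 < E t by exact: expR_gt0.
have zc : continuous_torus_time z.
  case: wc => wp wc; split => [t x j|p]; first by rewrite /z wp.
  apply: cvgM; last exact: wc.
  apply: (@continuous_comp _ _ _ snd E); first exact: cvg_snd.
  move=> s; apply: (@continuous_comp _ _ _ (fun s => - (K + 1) * s) expR).
    by apply: cvgM; [exact: cvg_cst|exact: cvg_id].
  exact: continuous_expR.
have [x0 [t0 [/andP[at0 t0b] zmin]]] := torus_time_min zc ab.
have z0 : z x0 t0 < 0.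
  apply: le_lt_trans (zmin y b _) _; first by rewrite ab lexx.
  by rewrite /z pmulr_rlt0.
have w0 : w x0 t0 < 0 by rewrite /z pmulr_rlt0 in z0.
have {}at0 : a < t0.
  rewrite lt_def at0 andbT; apply/eqP => t0a.
  by have := wa x0; rewrite -t0a leNgt w0.
have l0 : l x0 t0 <= 0.
  apply: (half_laplacian_min_le0 (lc t0) (wl t0)) => x.
  by rewrite -(ler_pM2l (E0 t0)); apply: zmin; rewrite (ltW at0).
have dz : is_derive t0 (1 : R) (z x0) (E t0 * (wt x0 t0 - (K + 1) * w x0 t0)).
  have wd0 := wd x0 t0.
  rewrite /z /E; apply: is_derive_eq; rewrite /GRing.scale /=.
  by ring.
(* Here [wt - (K + 1) w >= - l - w >= - w > 0]: the extra 1 in the exponent supplies strictness. *)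
have dz0 : 0 < E t0 * (wt x0 t0 - (K + 1) * w x0 t0).
  rewrite mulr_gt0 //; have := weq x0 t0 (ltW at0) w0; lra.
have [r /andP[ar rt0]] := is_derive_gt0_left dz dz0 at0.
by rewrite ltNge zmin // ar (le_trans (ltW rt0)).
Qed.

(** The Poisson semigroup started at time [a], in closed form on trigonometric polynomials. *)
Lemma half_laplacian_flow_eval (R : realType) (n : nat) (a : R)
  (s : seq ('rV[int]_n * (R * R))) :
  let P t := trig_mul (fun k : 'rV[int]_n => expR (- freq_norm R k * (t - a))) s in
  half_laplacian_flow (fun x t => trig_eval (P t) x)
    (fun x t => - trig_eval (trig_mul (freq_norm R (n := n)) (P t)) x)
    (fun x t => trig_eval (trig_mul (freq_norm R (n := n)) (P t)) x).
Proof.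
move=> P; split.
- split => [t|p]; first by case: (torus_continuous_eval (P t)).
  rewrite /P; under eq_fun do rewrite trig_mulE.
  apply: (@cvg_big _ _ _ _ _ _ _ (nbhs p)) => [|t _]; first exact: add_continuous.
  apply: cvgM.
    apply: (@continuous_comp _ _ _ snd (fun r : R => expR (- freq_norm R t.1 * (r - a)))).
      exact: cvg_snd.
    move=> r; apply: (@continuous_comp _ _ _ (fun r => - freq_norm R t.1 * (r - a)) expR).
      apply: cvgM; first exact: cvg_cst.
      by apply: cvgB; [exact: cvg_id|exact: cvg_cst].
    exact: continuous_expR.
  have [+ _] := torus_continuous_eval [:: t] => /(_ p.1) tc.
  have E x : t.2.1 * cos (freq_dot t.1 x) + t.2.2 * sin (freq_dot t.1 x) =
    trig_eval [:: t] x by rewrite /trig_eval big_seq1.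
  under eq_fun do rewrite E; rewrite E.
  by apply: (@continuous_comp _ _ _ fst (trig_eval [:: t])); [exact: cvg_fst|].
- move=> x t; rewrite /P trig_mul_comp trig_mulE; under eq_fun do rewrite trig_mulE.
  elim: s {P} => [|h s IH].
    under eq_fun do rewrite big_nil; rewrite big_nil oppr0.
    exact: is_derive_cst.
  under eq_fun do rewrite big_cons; rewrite big_cons opprD.
  apply: is_deriveD => //.
  apply: is_derive_eq; rewrite /GRing.scale /=.
  by ring.
- by move=> t; exact: torus_continuous_eval.
- by move=> t; exact: trig_approx_eval.
Qed.

(** Nonzero integer frequencies have [|k| >= 1], so everything but the mean decays at least like
    [exp (- t)]. *)
Lemma trig_eval_decay (R : realType) (n : nat) (t : R)
  (s : seq ('rV[int]_n * (R * R))) (x : 'rV[R]_n) : 0 <= t ->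
  trig_mean s - expR (- t) * (\sum_(h <- s) (`|h.2.1| + `|h.2.2|)) <=
  trig_eval (trig_mul (fun k : 'rV[int]_n => expR (- freq_norm R k * t)) s) x.
Proof.
move=> t0; rewrite trig_mulE /trig_mean big_mkcond mulr_sumr -sumrB.
apply: ler_sum => -[k [a b]] _ /=.
have [->|k0] := eqVneq k 0.
  rewrite freq_norm0 oppr0 mul0r expR0 mul1r freq_dot0l cos0 sin0 mulr1 mulr0 addr0.
  by rewrite gerBl mulr_ge0 ?expR_ge0 ?addr_ge0.
rewrite sub0r -mulrN.
have e1 : expR (- freq_norm R k * t) <= expR (- t).
  rewrite ler_expR -[leRHS]mulN1r ler_wpM2r // lerN2; exact: freq_norm_ge1.
set D := a * _ + _.
have D1 : - (`|a| + `|b|) <= D.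
  have h1 : `|a * cos (freq_dot k x)| <= `|a|.
    by rewrite normrM -[leRHS]mulr1 ler_wpM2l ?cos_max.
  have h2 : `|b * sin (freq_dot k x)| <= `|b|.
    by rewrite normrM -[leRHS]mulr1 ler_wpM2l ?sin_max.
  by move: h1 h2; rewrite !ler_norml /D; lra.
apply: (@le_trans _ _ (expR (- freq_norm R k * t) * - (`|a| + `|b|))).
  by rewrite !mulrN lerN2 ler_wpM2r // addr_ge0.
by rewrite ler_wpM2l ?expR_ge0.
Qed.

(** * Solutions *)

Lemma continuous_pair (T U V : topologicalType) (f : T -> U) (g : T -> V) (x : T) :
  {for x, continuous f} -> {for x, continuous g} ->
  {for x, continuous (fun y => (f y, g y))}.
Proof.
move=> fx gx P [[A B] /= [xA xB] AB].
have H := @filterI _ (nbhs x) (nbhs_filter x) _ _ (fx _ xA) (gx _ xB).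
suff : nbhs x [set y | P (f y, g y)] by [].
by apply: (@filterS _ _ (nbhs_filter x) _ _ _ H) => y [Ay By]; exact: AB.
Qed.

Lemma torus_continuous_time_slice (R : realType) (n : nat)
  (h : 'rV[R]_n -> R -> R) (t : R) :
  continuous_torus_time h -> torus_continuous (fun x => h x t).
Proof.
move=> [hp hc]; split; last exact: hp.
move=> x; apply: (@continuous_comp _ _ _ (fun x => (x, t))
  (fun p : 'rV[R]_n * R => h p.1 p.2)); last exact: hc.
by apply: continuous_pair; [exact: cvg_id|exact: cst_continuous].
Qed.

Lemma shift_int (R : realType) (f : R -> R) (T c : R) (z : int) (t : R) :
  (forall t, f (t + T) = f t + c) -> f (t + T * z%:~R) = f t + c * z%:~R.
Proof.
move=> fT.
have pos (i : nat) (s : R) : f (s + T * i%:R) = f s + c * i%:R.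
  elim: i s => [|i IH] s; first by rewrite !mulr0 !addr0.
  by rewrite -[i.+1%:R]natr1 !mulrDr !mulr1 !addrA fT IH.
case: z => i; first exact: pos.
rewrite NegzE mulrNz !mulrN.
by have := pos i.+1 (t - T * i.+1%:R); rewrite subrK => ->; rewrite addrK.
Qed.

Lemma expR_le_inv (R : realType) (y : R) : 0 <= y -> expR (- y) <= (1 + y)^-1.
Proof.
by move=> y0; rewrite expRN lef_pV2 ?posrE ?expR_gt0 ?expR_ge1Dx //; lra.
Qed.

(* From time [t1] on, [e^(K(t-t1)) w] dominates the exact solution starting from
   a trigonometric polynomial below [w t1], which converges to its mean. *)
Lemma half_laplacian_strong_positivity (R : realType) (n : nat)
  (w wt l : 'rV[R]_n -> R -> R) (K T : R) (x1 : 'rV[R]_n) (t1 : R) :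
  half_laplacian_flow w wt l -> 0 < T -> (forall x t, w x (t + T) = w x t) ->
  (forall x t, 0 <= w x t) -> (forall x t, - l x t - K * w x t <= wt x t) ->
  0 < w x1 t1 -> forall x t, 0 < w x t.
Proof.
move=> flow T0 wT w0 weq wx1.
have [wc wd lc wl] := flow.
pose u x := w x t1.
have uc : torus_continuous u by exact: torus_continuous_time_slice.
have P0 : 0 < (2 * pi) ^+ n :> R by rewrite exprn_gt0 // mulr_gt0 // pi_gt0.
have I0 : 0 < torus_integral u by apply: (torus_integral_gt0 uc _ wx1) => x; exact: w0.
(* A quarter of the mean of [u]: an [e]-approximation lowered by [e] lies between [u - 2 e] and [u],
   so it stays below [u] and keeps at least half of the mean. *)
pose e : R := torus_integral u / (4 * (2 * pi) ^+ n).
have e0 : 0 < e by rewrite divr_gt0 // mulr_gt0.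
have [s0 s0P] := wl t1 e e0.
pose s := (0, (- e, 0)) :: s0.
have sE x : trig_eval s x = trig_eval s0 x - e.
  by rewrite /s {1}/trig_eval big_cons /= freq_dot0l cos0 sin0; rewrite addrC;
    congr (_ + _); ring.
have su x : trig_eval s x <= u x.
  by rewrite sE; have [+ _] := s0P x; rewrite ler_norml -/(u x); lra.
have m0 : 0 < trig_mean s.
  rewrite -(pmulr_lgt0 _ P0) -torus_integral_eval.
  have : torus_integral u + (- (2 * e)) * (2 * pi) ^+ n <= torus_integral (trig_eval s).
    rewrite -torus_integral_cst -torus_integralD //; last first.
      exact: torus_continuous_cst.
    apply: torus_integral_le; last 1 first.
    - by move=> x; rewrite sE; have [+ _] := s0P x; rewrite ler_norml -/(u x); lra.
    - exact/torus_continuousD/torus_continuous_cst.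
    - exact: torus_continuous_eval.
  apply: lt_le_trans.
  have -> : torus_integral u + - (2 * e) * (2 * pi) ^+ n = torus_integral u / 2.
    by rewrite /e; field; rewrite gt_eqF.
  by rewrite divr_gt0.
pose S : R := \sum_(h <- s) (`|h.2.1| + `|h.2.2|).
have S0 : 0 <= S by apply: sumr_ge0 => h _; exact: addr_ge0.
pose P t := trig_mul (fun k : 'rV[int]_n => expR (- freq_norm R k * (t - t1))) s.
have [bc bd blc bl] := half_laplacian_flow_eval t1 s; rewrite -/P in bc bd blc bl.
pose E (t : R) := expR (K * (t - t1)).
have E0 t : 0 < E t by exact: expR_gt0.
pose z x t := E t * w x t - trig_eval (P t) x.
pose zt x t := E t * (K * w x t + wt x t) +
  trig_eval (trig_mul (freq_norm R (n := n)) (P t)) x.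
pose zl x t := E t * l x t - trig_eval (trig_mul (freq_norm R (n := n)) (P t)) x.
have zflow : half_laplacian_flow z zt zl.
  split.
  - split => [t x j|p]; first by rewrite /z (wc.1 t) (bc.1 t).
    apply: cvgB; last exact: bc.2.
    apply: cvgM; last exact: wc.2.
    apply: (@continuous_comp _ _ _ snd E); first exact: cvg_snd.
    move=> r; apply: (@continuous_comp _ _ _ (fun r => K * (r - t1)) expR).
      apply: cvgM; first exact: cvg_cst.
      by apply: cvgB; [exact: cvg_id|exact: cvg_cst].
    exact: continuous_expR.
  - move=> x t; have wdt := wd x t; have bdt := bd x t.
    rewrite /z /zt /E; apply: is_derive_eq; rewrite /GRing.scale /=.
    by ring.
  - move=> t; apply: torus_continuousD; first exact: torus_continuousZ.
    under eq_fun do rewrite -mulN1r.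
    exact/torus_continuousZ/torus_continuous_eval.
  - move=> t; apply: trig_approxD; first exact: trig_approxZ.
    have := trig_approxZ (-1) (bl t).
    under eq_fun do rewrite mulN1r.
    by under [X in trig_approx _ X]eq_fun do rewrite mulN1r.
(* The sum [zt + zl] equals [E t * (K * w + wt + l)], which is nonnegative by hypothesis, so the
   comparison applies with constant 0. *)
have z0 x t : t1 <= t -> 0 <= z x t.
  apply: (half_laplacian_comparison (K := 0) zflow) => [y r _ _|y].
    rewrite mul0r addr0 /zl /zt opprB addrC lerD2r.
    rewrite -mulrN ler_pM2l //; have := weq y r; lra.
  rewrite /z /E subrr mulr0 expR0 mul1r subr_ge0 /P.
  have -> : trig_mul (fun k : 'rV[int]_n => expR (- freq_norm R k * (t1 - t1))) s = s.
    rewrite -[RHS]map_id; apply: eq_map => -[k [a b]] /=.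
    by rewrite subrr mulr0 expR0 !mul1r.
  exact: su.
move=> x t.
set m := trig_mean s in m0.
(* Enough periods to reach a time [r] with [r - t1 >= S / m]; by [exp (- y) <= 1 / (1 + y)] the
   decaying part is then smaller than the mean [m]. *)
pose q : R := (`|t1 - t| + S / m) / T.
have Tq : `|t1 - t| + S / m <= T * (Num.trunc q).+1%:R.
  by rewrite [leRHS]mulrC -ler_pdivrMr // -/q; apply: ltW; exact: truncnS_gt.
pose r := t + T * (Num.trunc q).+1%:R.
have rt1 : S / m <= r - t1 by have := ler_norm (t1 - t); rewrite /r; lra.
have Sm0 : 0 <= S / m by rewrite divr_ge0 // ltW.
have r0 : 0 <= r - t1 by exact: le_trans rt1.
have decay : 0 < trig_eval (P r) x.
  apply: lt_le_trans (trig_eval_decay s x r0); rewrite -/m -/S subr_gt0.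
  apply: (@le_lt_trans _ _ ((1 + (r - t1))^-1 * S)).
    by rewrite ler_wpM2r // expR_le_inv.
  rewrite mulrC ltr_pdivrMr; last lra.
  move: rt1; rewrite ler_pdivrMr //; nra.
have <- : w x r = w x t.
  have := @shift_int _ (w x) T 0 (Num.trunc q).+1%:Z t.
  by rewrite mul0r addr0; apply => ?; rewrite addr0.
rewrite -(pmulr_rgt0 _ (E0 r)).
by have := z0 x r; rewrite -subr_ge0 => /(_ r0); rewrite /z; lra.
Qed.

Lemma lipschitz_snd (R : realType) (n : nat) (phi : 'rV[R]_n -> R -> R) :
  [lipschitz phi p.1 p.2 | p in [set: 'rV[R]_n * R]] ->
  exists2 K : R, 0 <= K &
    forall x a b, `|phi x a - phi x b| <= K * `|a - b|.
Proof.
move=> /(@filterI _ _ _ _ _ (nbhs_pinfty_ge (num_real 0))) /filter_ex [K [K0 KL]].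
exists K => // x a b; have := KL ((x, a), (x, b)) (conj I I) => /=.
rewrite [X in _ <= K * X -> _](_ : _ = `|a - b|) // .
by rewrite prod_normE /= subrr normr0 max_r.
Qed.

Lemma classical_solution_flow (R : realType) (n : nat)
  (phi : 'rV[R]_n -> R -> R) (F s : R) (g1 g2 : 'rV[R]_n -> R -> R) :
  classical_solution phi F g1 -> classical_solution phi F g2 ->
  exists wt l, half_laplacian_flow (fun x t => g2 x (t + s) - g1 x t) wt l /\
    forall x t, wt x t = - l x t + (phi x (g2 x (t + s)) - phi x (g1 x t)).
Proof.
have shift (h : 'rV[R]_n -> R -> R) : continuous_torus_time h ->
    continuous_torus_time (fun x t => h x (t + s)).
  move=> [hp hc]; split => [t|p]; first exact: hp.
  apply: (@continuous_comp _ _ _ (fun p : 'rV[R]_n * R => (p.1, p.2 + s))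
    (fun p => h p.1 p.2)); last exact: hc.
  apply: continuous_pair; first exact: cvg_fst.
  by apply: cvgD; [exact: cvg_snd|exact: cvg_cst].
have sub (h k : 'rV[R]_n -> R -> R) : continuous_torus_time h ->
    continuous_torus_time k -> continuous_torus_time (fun x t => h x t - k x t).
  move=> [hp hc] [kp kc]; split => [t x j|p]; first by rewrite hp kp.
  by apply: cvgB; [exact: hc|exact: kc].
pose slice := @torus_continuous_time_slice R n.
move=> [g1c [gt1 [L1 [gt1c g1d L1c L1h g1eq]]]] [g2c [gt2 [L2 [gt2c g2d L2c L2h g2eq]]]].
exists (fun x t => gt2 x (t + s) - gt1 x t), (fun x t => L2 x (t + s) - L1 x t).
split; last by move=> x t; rewrite g1eq g2eq; ring.
split.
- exact/sub/g1c/shift.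
- move=> x t; have d1 := g1d x t; have d2 := g2d x (t + s).
  have D := @is_derive1_comp R (g2 x) (fun r => r + s) t (gt2 x (t + s)) 1 d2 _.
  have e1 : is_derive t (1 : R) (fun r : R => r + s) 1.
    by apply: is_derive_eq; rewrite addr0.
  have := D e1; rewrite mulr1 => {D}D.
  exact: is_deriveB.
- move=> t; apply: (slice (fun x t => L2 x (t + s) - L1 x t)).
  exact/sub/L1c/shift.
- move=> t.
  have h2 := half_laplacian_trig_approx (slice _ (t + s) g2c) (slice _ (t + s) L2c)
    (L2h (t + s)).
  have h1 := half_laplacian_trig_approx (slice _ t g1c) (slice _ t L1c) (L1h t).
  have := trig_approxD h2 (trig_approxZ (-1) h1).
  under eq_fun do rewrite mulN1r.
  under [X in trig_approx _ X]eq_fun do rewrite mulN1r.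
  exact.
Qed.

Lemma classical_solution_comparison (R : realType) (n : nat)
  (phi : 'rV[R]_n -> R -> R) (F s a : R) (g1 g2 : 'rV[R]_n -> R -> R) :
  [lipschitz phi p.1 p.2 | p in [set: 'rV[R]_n * R]] ->
  classical_solution phi F g1 -> classical_solution phi F g2 ->
  (forall x, g1 x a <= g2 x (a + s)) ->
  forall x t, a <= t -> g1 x t <= g2 x (t + s).
Proof.
move=> /lipschitz_snd [K K0 KL] g1s g2s ga x t at_.
have [wt [l [flow weq]]] := classical_solution_flow s g1s g2s.
rewrite -subr_ge0.
apply: (half_laplacian_comparison (K := K) flow _ _ x at_) => [y r _ w0|y].
  rewrite weq lerD2l.
  have := KL y (g2 y (r + s)) (g1 y r).
  by rewrite (ltr0_norm w0) ler_norml mulrN opprK => /andP[].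
by rewrite subr_ge0.
Qed.

Lemma classical_solution_strong (R : realType) (n : nat)
  (phi : 'rV[R]_n -> R -> R) (F s T : R) (g1 g2 : 'rV[R]_n -> R -> R) x0 t0 :
  [lipschitz phi p.1 p.2 | p in [set: 'rV[R]_n * R]] ->
  classical_solution phi F g1 -> classical_solution phi F g2 -> 0 < T ->
  (forall x t, g1 x (t + T) = g1 x t + 1) ->
  (forall x t, g2 x (t + T) = g2 x t + 1) ->
  (forall x t, g1 x t <= g2 x (t + s)) -> g1 x0 t0 = g2 x0 (t0 + s) ->
  forall x t, g1 x t = g2 x (t + s).
Proof.
move=> /lipschitz_snd [K K0 KL] g1s g2s T0 g1T g2T g12 g0 x t.
have [wt [l [flow weq]]] := classical_solution_flow s g1s g2s.
apply/eqP; rewrite eq_le g12 /= leNgt; apply/negP; rewrite -subr_gt0 => pos.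
have : 0 < g2 x0 (t0 + s) - g1 x0 t0.
  apply: (half_laplacian_strong_positivity (K := K) flow T0 _ _ _ pos) => y r.
  - by rewrite addrAC g2T g1T; ring.
  - by rewrite subr_ge0.
  rewrite weq lerD2l; have := KL y (g2 y (r + s)) (g1 y r).
  rewrite (ger0_norm (_ : 0 <= g2 y (r + s) - g1 y r)) ?subr_ge0 //.
  by rewrite ler_norml => /andP[].
by rewrite g0 subrr ltxx.
Qed.

(** * Periods and time shifts of solutions *)

Lemma floor_shift (R : realType) (t T : R) : 0 < T ->
  exists z : int, 0 <= t + T * z%:~R <= T.
Proof.
move=> T0; exists (- Num.floor (t / T)).
have h1 := Num.Theory.floor_le (t / T); have h2 := Num.Theory.floorD1_gt (t / T).
move: h1 h2; rewrite intrD mulrNz ler_pdivlMr // ltr_pdivrMr //.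
by move: ((Num.floor (t / T))%:~R : R) => f h1 h2; apply/andP; split; lra.
Qed.

(* [g x t - t / T] is periodic in all variables. *)
Lemma shift_bounded (R : realType) (n : nat) (g : 'rV[R]_n -> R -> R) (T : R) :
  continuous_torus_time g -> 0 < T ->
  (forall x t, g x (t + T) = g x t + 1) ->
  exists2 B : R, 0 <= B & forall x t, `|g x t - t / T| <= B.
Proof.
move=> gc T0 gT.
have [|B [B0 HB]] := @torus_time_bounded _ _ (fun x t => g x t - t / T) 0 T _ (ltW T0).
  case: gc => gp gc; split => [t x j|p]; first by rewrite gp.
  apply: cvgB; first exact: gc.
  by apply: cvgM; [exact: cvg_snd|exact: cvg_cst].
exists B => // x t; have [z zP] := floor_shift t T0.
have := HB x _ zP; rewrite (@shift_int _ (g x) T 1) // mul1r.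
suff -> : g x t + z%:~R - (t + T * z%:~R) / T = g x t - t / T by [].
by field; rewrite gt_eqF.
Qed.

Lemma shift_period_ge (R : realType) (n : nat)
  (phi : 'rV[R]_n -> R -> R) (F T1 T2 : R) (g1 g2 : 'rV[R]_n -> R -> R) :
  [lipschitz phi p.1 p.2 | p in [set: 'rV[R]_n * R]] ->
  classical_solution phi F g1 -> classical_solution phi F g2 ->
  0 < T1 -> 0 < T2 ->
  (forall x t, g1 x (t + T1) = g1 x t + 1) ->
  (forall x t, g2 x (t + T2) = g2 x t + 1) -> T2 <= T1.
Proof.
move=> phiL g1s g2s T10 T20 g1T g2T; rewrite leNgt; apply/negP => T12.
have [B1 B10 H1] := shift_bounded g1s.1 T10 g1T.
have [B2 B20 H2] := shift_bounded g2s.1 T20 g2T.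
pose d := T1^-1 - T2^-1.
have d0 : 0 < d by rewrite subr_gt0 ltf_pV2.
(* After time [A] the two linear drifts differ by [B1 + B2 + 1], more than both oscillations
   together: [g1] is below [g2] at [- A] and above it at [A]. *)
pose A := (B1 + B2 + 1) / d.
have AE : A * d = B1 + B2 + 1 by rewrite divfK // gt_eqF.
have A0 : 0 <= A by rewrite divr_ge0 ?(ltW d0) //; lra.
have : g1 0 A <= g2 0 (A + 0).
  apply: (classical_solution_comparison (a := - A) phiL g1s g2s); last lra.
  move=> x; have := H1 x (- A); have := H2 x (- A + 0).
  by rewrite addr0 !ler_norml; move: AE; rewrite /d; lra.
have := H1 0 A; have := H2 0 (A + 0).
by rewrite addr0 !ler_norml; move: AE; rewrite /d; lra.
Qed.

(* The least admissible shift makes the two solutions touch: if they stayed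
   apart over a period, compactness would leave room for a smaller shift. *)
Lemma least_shift_touches (R : realType) (n : nat)
  (g1 g2 : 'rV[R]_n -> R -> R) (T : R) :
  continuous_torus_time g1 -> continuous_torus_time g2 -> 0 < T ->
  (forall x t, g1 x (t + T) = g1 x t + 1) ->
  (forall x t, g2 x (t + T) = g2 x t + 1) ->
  exists s, (forall x t, g1 x t <= g2 x (t + s)) /\
    exists x t, g1 x t = g2 x (t + s).
Proof.
move=> g1c g2c T0 g1T g2T.
have [B1 B10 H1] := shift_bounded g1c T0 g1T.
have [B2 B20 H2] := shift_bounded g2c T0 g2T.
pose S := [set s | forall x t, g1 x t <= g2 x (t + s)].
have S0 : S !=set0.
  (* This shift raises the drift of [g2] by [B1 + B2], which covers both oscillations. *)
  exists ((B1 + B2) * T) => x t.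
  have := H1 x t; have := H2 x (t + (B1 + B2) * T).
  by rewrite [(t + _) / T]mulrDl mulfK ?gt_eqF // !ler_norml; lra.
have Slb : has_lbound S.
  exists (- (B1 + B2) * T) => s Ss; rewrite -ler_pdivlMr //.
  have := Ss 0 0; have := H1 0 0; have := H2 0 (0 + s).
  by rewrite !add0r mul0r !ler_norml; lra.
pose s := inf S.
have g2t x : continuous (g2 x).
  move=> t; apply: (@continuous_comp _ _ _ (fun t => (x, t))
    (fun p : 'rV[R]_n * R => g2 p.1 p.2)); last exact: g2c.2.
  by apply: continuous_pair; [exact: cst_continuous|exact: cvg_id].
(* The infimum is attained: a strict violation at [s] would, by continuity of [g2] in time, persist
   for nearby elements of [S]. *)
have Ss : S s.
  move=> x t; rewrite leNgt; apply/negP => lt21.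
  have : \forall r \near s, g2 x (t + r) < g1 x t.
    have C : g2 x (t + r) @[r --> s] --> g2 x (t + s).
      apply: (@continuous_comp _ _ _ (fun r => t + r) (g2 x)); last exact: g2t.
      by apply: cvgD; [exact: cvg_cst|exact: cvg_id].
    exact: (cvgr_lt _ C).
  move=> /nbhs_ballP [r /= r0 rP].
  have [q Sq qs] := inf_adherent r0 (conj S0 Slb).
  have : g2 x (t + q) < g1 x t.
    apply: rP; rewrite -ball_normE /= ltr_norml.
    have : s <= q by exact: inf_lbound.
    by move: qs; rewrite -/s; lra.
  by rewrite ltNge Sq.
exists s; split => //.
apply: contrapT => /forallNP notouch.
have gap x t : g1 x t < g2 x (t + s).
  rewrite lt_neqAle Ss andbT; apply/eqP => E.
  by apply: (notouch x); exists t.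
have K := compact_setX (@compact_cube R n) (@segment_compact _ 0 T).
(* Over one compact cell, the strict inequality survives every sufficiently small decrease [e] of
   the shift, with a threshold independent of the point. *)
have /compact_near_coveringP /(_ R (nbhs (0 : R))
  (fun e p => 0 < g2 p.1 (p.2 + s - e) - g1 p.1 p.2) (nbhs_filter _)) [] := K.
  move=> [x t] _ /=.
  have C : {for ((x, t), (0 : R)), continuous
      (fun p : ('rV[R]_n * R) * R => g2 p.1.1 (p.1.2 + s - p.2) - g1 p.1.1 p.1.2)}.
    apply: cvgB.
      apply: (@continuous_comp _ _ _ (fun p : ('rV[R]_n * R) * R =>
        (p.1.1, p.1.2 + s - p.2)) (fun p => g2 p.1 p.2)); last exact: g2c.2.
      apply: continuous_pair.
        by apply: (@continuous_comp _ _ _ fst fst); exact: cvg_fst.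
      apply: cvgB; last exact: cvg_snd.
      apply: cvgD; last exact: cvg_cst.
      by apply: (@continuous_comp _ _ _ fst snd); [exact: cvg_fst|exact: cvg_snd].
    by apply: (@continuous_comp _ _ _ fst (fun p => g1 p.1 p.2));
      [exact: cvg_fst|exact: g1c.2].
  by apply: (cvgr_gt _ C); rewrite /= subr0 subr_gt0.
move=> r /= r0 rP.
have r20 : 0 < r / 2 by rewrite divr_gt0.
(* Any point moves into the cell by lattice and period translations; as the period is common, both
   solutions change by the same integer and the inequality is preserved. *)
have : S (s - r / 2).
  move=> x t.
  have [z zP] := floor_shift t T0; have [m mP] := torus_reduce x.
  have : 0 < g2 (x + torus_shift R m) (t + T * z%:~R + s - r / 2) -
      g1 (x + torus_shift R m) (t + T * z%:~R).
    apply: (rP (r / 2) _ (x + torus_shift R m, t + T * z%:~R)) => /=.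
      by rewrite sub0r normrN gtr0_norm //; lra.
    by split => //=; rewrite in_itv.
  have -> : t + T * z%:~R + s - r / 2 = t + (s - r / 2) + T * z%:~R by ring.
  rewrite (@shift_int _ (g2 _) T 1) // (@shift_int _ (g1 _) T 1) //.
  rewrite (torus_periodic_shift m x (g2c.1 _)) (torus_periodic_shift m x (g1c.1 _)).
  by rewrite mul1r; lra.
move=> /(inf_lbound Slb); rewrite -/s; lra.
Qed.

Unset Implicit Arguments.

Theorem proposition3p8 (R : realType) (n : nat)
  (phi : 'rV[R]_n -> R -> R) (F : R) (g1 g2 : 'rV[R]_n -> R -> R) (T1 T2 : R)
  (phi_periodic_x : forall y : R, torus_periodic (fun x => phi x y))
  (phi_lipschitz : [lipschitz phi p.1 p.2 | p in [set: 'rV[R]_n * R]])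
  (phi_periodic_y : forall (x : 'rV[R]_n) (y : R), phi x (y + 1) = phi x y)
  (phi_mean0 : \int[@lebesgue_measure R]_(y in `[0, 1[)
                 torus_integral (fun x => phi x y) = 0)
  (F_ge0 : 0 <= F)
  (g1_sol : classical_solution phi F g1)
  (g2_sol : classical_solution phi F g2)
  (T1_gt0 : 0 < T1) (T2_gt0 : 0 < T2)
  (g1_shift : forall (x : 'rV[R]_n) (t : R), g1 x (t + T1) = g1 x t + 1)
  (g2_shift : forall (x : 'rV[R]_n) (t : R), g2 x (t + T2) = g2 x t + 1) :
  T1 = T2 /\
  exists t0 : R, forall (x : 'rV[R]_n) (t : R), g1 x t = g2 x (t + t0).
Proof.
have T12 : T1 = T2.
  apply/eqP; rewrite eq_le.
  by rewrite (shift_period_ge phi_lipschitz g2_sol g1_sol) //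
    (shift_period_ge phi_lipschitz g1_sol g2_sol).
split => //; rewrite -T12 in g2_shift.
have [s [g12 [x0 [t0 touch]]]] :=
  least_shift_touches g1_sol.1 g2_sol.1 T1_gt0 g1_shift g2_shift.
exists s; exact: (classical_solution_strong phi_lipschitz g1_sol g2_sol T1_gt0
  g1_shift g2_shift g12 touch).
Qed.
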